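(* Given a pseudo-Riemannian metric $h$ on a manifold $M$, there is a unique holonomic symmetry jet $\mathfrak s$ on $M$ such that, at all points $x\in M$, the $(-1)$-eigenspace of $\Psi^{\mathfrak s}$ in $T_{h_x}S^2(M)$ coincides with $h_{*_x}(T_xM)$.
   Context: All objects are smooth. A holonomic symmetry jet on $M$ is a smooth assignment $x\mapsto\mathfrak s(x)=j^2_xs_x$, where $s_x$ is a local diffeomorphism of $M$ near $x$ with $s_x(x)=x$ and $(s_x)_{*_x}=-\mathrm{id}_{T_xM}$. Let $\pi:S^2(M)\to M$ be the vector bundle of covariant symmetric $2$-tensors on $M$; a metric $h$ is viewed as a section $h:M\to S^2(M)$ with differential $h_{*_x}:T_xM\to T_{h_x}S^2(M)$. A linear isomorphism $\xi:T_xM\to T_yM$ acts on symmetric $2$-tensors by $(\xi\cdot g)(X_y,Y_y)=g(\xi^{-1}X_y,\xi^{-1}Y_y)$, $g\in S^2(M)_x$. The map $\Psi^{\mathfrak s}:TS^2(M)\to TS^2(M)$, covering the identity of $S^2(M)$, is the involutive vector bundle map defined by $$\Psi^{\mathfrak s}\Bigl(\tfrac{dg_t}{dt}\Bigl|_{t=0}\Bigr)=\tfrac{d}{dt}\bigl((s_x)_{*_{x_t}}\cdot g_t\bigr)\Bigl|_{t=0},$$ where $t\mapsto g_t$ is a path in $S^2(M)$, $x_t=\pi(g_t)$ and $x=x_0$ (note that $(s_x)_{*_x}\cdot g_0=g_0$); it depends only on $\mathfrak s$. *)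

(* Defs.v *)
From HB Require Import structures.
From mathcomp Require Import all_boot all_order all_algebra.
From mathcomp Require Import all_classical all_reals all_analysis.
Set Implicit Arguments.
Unset Strict Implicit.
Unset Printing Implicit Defensive.
Import Order.TTheory GRing.Theory Num.Theory numFieldNormedType.Exports.
Local Open Scope classical_set_scope.
Local Open Scope ring_scope.

Section SmoothMaps.
Context {R : realType} {E F : normedModType R}.
Implicit Types (f : E -> F) (a : E).

(* iterD [:: v1; ...; vk] f a is the iterated derivative D_v1 (... (D_vk f)) (a),
   i.e. the k-th derivative D^k f(a)(v1, ..., vk) when f is smooth. *)
Definition iterD (vs : seq E) f : E -> F :=
  foldr (fun v g => fun a => 'D_v g a) f vs.

Definition smooth_pt f a := forall vs : seq E, differentiable (iterD vs f) a.

Definition smooth_near f a := \forall u \near a, smooth_pt f u.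

End SmoothMaps.

(* A preferred chart around each point p of N: coord C p is meaningful on
   dom C p only. No topology on N is needed, because this is only used for the
   targets of maps. *)
Record charts (R : realType) (N : Type) (E : normedModType R) := Charts {
  dom : N -> set N ;
  coord : N -> N -> E }.

(* The tangent space at p, read in the preferred chart at p. *)
Definition tangent (R : realType) (N : Type) (E : normedModType R)
  (C : charts N E) (p : N) : normedModType R := E.

(* A smooth manifold of dimension n. Its smooth structure is given by an atlas
   indexed by the points: chart_map x is a chart around x, with inverse
   chart_inv x (meaningful on the image of chart_dom x only). Any smooth atlas
   can be so indexed, by choosing a chart around each point. *)
Record manifold (R : realType) (n : nat) := Manifold {
  carrier :> topologicalType ;
  chart_dom : carrier -> set carrier ;
  chart_map : carrier -> carrier -> 'rV[R]_n ;
  chart_inv : carrier -> 'rV[R]_n -> carrier ;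
  manifold_hausdorff : hausdorff_space carrier ;
  manifold_second_countable : @second_countable carrier ;
  chart_open : forall x, open (chart_dom x) ;
  chart_mem : forall x, chart_dom x x ;
  chart_mapK : forall x, {in chart_dom x, cancel (chart_map x) (chart_inv x)} ;
  chart_map_continuous : forall x y, chart_dom x y ->
    {for y, continuous (chart_map x)} ;
  chart_map_open : forall x (U : set carrier), open U -> U `<=` chart_dom x ->
    open (chart_map x @` U) ;
  chart_transition : forall x y z, chart_dom x z -> chart_dom y z ->
    smooth_pt (chart_map y \o chart_inv x) (chart_map x z) }.

Section Manifold.
Context {R : realType} {n : nat} {M : manifold R n}.
Implicit Types x y : M.

Definition mcharts : charts M 'rV[R]_n :=
  Charts (@chart_dom R n M) (@chart_map R n M).

(* This is tangent mcharts x, with its finite-dimensional structure. *)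
Definition TM x : vectType R := 'rV[R]_n.

Section Maps.
Context {N : Type} {E : normedModType R} (C : charts N E).

Definition local_rep (f : M -> N) x : 'rV[R]_n -> E :=
  coord C (f x) \o f \o chart_inv x.

Definition smooth_at (f : M -> N) x :=
  (\forall y \near x, dom C (f x) (f y)) /\
  smooth_near (local_rep f x) (chart_map x x).

Definition mdiff (f : M -> N) x : {linear TM x -> tangent C (f x)} :=
  'd (local_rep f x) (chart_map x x).

Definition smooth_path (c : R -> N) :=
  (\forall t \near 0, dom C (c 0) (c t)) /\
  smooth_near (coord C (c 0) \o c : R^o -> E) 0.

Definition velocity (c : R -> N) : tangent C (c 0) :=
  derive1 (coord C (c 0) \o c) 0.

End Maps.

Definition local_diffeo_at (s : M -> M) x :=
  exists (U : set M) (t : M -> M),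
    [/\ open U, U x, open (s @` U), {in U, cancel s t} &
        (forall y, U y -> smooth_at mcharts s y) /\
        (forall y, (s @` U) y -> smooth_at mcharts t y)].

(* The 2-jet of s at x, as the set of all maps that are smooth near x and have
   the same derivatives up to order 2 as s at x. *)
Definition jet2 x (s : M -> M) : set (M -> M) :=
  [set s' | [/\ smooth_at mcharts s' x, s' x = s x &
    forall vs : seq 'rV[R]_n, (size vs <= 2)%N ->
      iterD vs (local_rep mcharts s' x) (chart_map x x) =
      iterD vs (local_rep mcharts s x) (chart_map x x)]].

(* Smoothness of x |-> jet2 x (s x), as a section of J^2(M, M) -> M, in the
   standard coordinates (derivatives of order <= 2) of J^2(M, M) given by the
   charts at x0 in the source and at s x0 x0 in the target. *)
Definition smooth_jet2_field (s : M -> M -> M) :=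
  forall x0, let y0 := s x0 x0 in
    (\forall x \near x0, chart_dom y0 (s x x)) /\
    forall vs : seq 'rV[R]_n, (size vs <= 2)%N ->
      smooth_near
        (fun u => iterD vs (chart_map y0 \o s (chart_inv x0 u) \o chart_inv x0) u)
        (chart_map x0 x0).

(* s x = x identifies the targets TM (s x) and TM x in mdiff s x X = - X. *)
Definition symmetry_at x (s : M -> M) :=
  [/\ local_diffeo_at s x, s x = x & forall X : TM x, mdiff mcharts s x X = - X].

(* smooth_jet2_field s only depends on the jets jet2 x (s x), not on the
   representatives s x. *)
Definition holonomic_symmetry_jet (js : M -> set (M -> M)) :=
  exists s : M -> M -> M,
    [/\ forall x, symmetry_at x (s x), forall x, js x = jet2 x (s x) &
        smooth_jet2_field s].

End Manifold.

(* Symmetric bilinear forms on V. *)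
Record sym2 (R : realType) (V : lmodType R) := Sym2 {
  sym2_fun :> V -> V -> R ;
  sym2_linear : forall a X Y Z,
    sym2_fun (a *: X + Y) Z = a * sym2_fun X Z + sym2_fun Y Z ;
  sym2_sym : forall X Y, sym2_fun X Y = sym2_fun Y X }.

Section Action.
Context {R : realType} {V W : vectType R} (xi : 'Hom(V, W)) (g : sym2 V).

Let act_fun (X Y : W) : R := g ((xi^-1)%VF X) ((xi^-1)%VF Y).

Fact act_linear a X Y Z :
  act_fun (a *: X + Y) Z = a * act_fun X Z + act_fun Y Z.
Proof. by rewrite /act_fun linearP sym2_linear. Qed.

Fact act_sym X Y : act_fun X Y = act_fun Y X.
Proof. exact: sym2_sym. Qed.

Definition act : sym2 W := Sym2 act_linear act_sym.

End Action.

Definition sym_idx (n : nat) := {p : 'I_n * 'I_n | (p.1 <= p.2)%N}.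

Section S2.
Context {R : realType} {n : nat} {M : manifold R n}.

Definition S2 : Type := {x : M & sym2 (TM x)}.

Definition S2_point (x : M) (g : sym2 (TM x)) : S2 := existT _ x g.

(* The vector of TM y with i-th basis coordinates in the chart at x0. *)
Definition coord_vector (x0 y : M) (i : 'I_n) : TM y :=
  'd (chart_map y \o chart_inv x0) (chart_map x0 y) (delta_mx 0 i).

Definition S2_components (x0 : M) (p : S2) : 'rV[R]_#|{: sym_idx n}| :=
  \row_k let ij := val (enum_val k) in
    projT2 p (coord_vector x0 (projT1 p) ij.1) (coord_vector x0 (projT1 p) ij.2).

(* On S^2(M), the chart around p is induced by the chart of M around the base
   point of p; fibre coordinates are the entries i <= j of the symmetric matrix
   of a tensor in the coordinate basis. *)
Definition S2_charts : charts S2 ('rV[R]_n * 'rV[R]_#|{: sym_idx n}|)%type :=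
  Charts (fun p => (@projT1 _ _) @^-1` chart_dom (projT1 p))
    (fun p q => (chart_map (projT1 p) (projT1 q), S2_components (projT1 p) q)).

Definition push (s : M -> M) (p : S2) : S2 :=
  let x := projT1 p in
  let ds : 'Hom(TM x, TM (s x)) := linfun (mdiff mcharts s x) in
  S2_point (act ds (projT2 p)).

(* The value of Psi at X = c'(0) is the velocity of the transported path at 0; it
   depends neither on the path c nor on the representative s of the jet, and
   xget picks this unique value. *)
Definition Psi (js : M -> set (M -> M)) (p : S2) (X : tangent S2_charts p) :
    tangent S2_charts p :=
  xget 0 [set Y | exists (s : M -> M) (c : R -> S2),
    [/\ js (projT1 p) s, smooth_path S2_charts c, c 0 = p,
        velocity S2_charts c = X & velocity S2_charts (push s \o c) = Y]].

Definition pseudo_Riemannian_metric (h : forall x : M, sym2 (TM x)) :=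
  (forall x, smooth_at S2_charts (fun y => S2_point (h y)) x) /\
  (forall x X, (forall Y, h x X Y = 0) -> X = 0).

End S2.

Arguments S2 {R n} M.
Arguments Psi {R n M} js p X.

(* Main.v *)
Require Import Defs.
From HB Require Import structures.
From mathcomp Require Import all_boot all_order all_algebra.
From mathcomp Require Import all_classical all_reals all_analysis.
From mathcomp Require Import ring lra.
Import Order.TTheory GRing.Theory Num.Theory numFieldNormedType.Exports.
Local Open Scope classical_set_scope.
Local Open Scope ring_scope.
Set Implicit Arguments.
Unset Strict Implicit.
Unset Printing Implicit Defensive.
(**
Read in the chart at x, a symmetry s at x is a map sigma that fixes the image
a of x and has differential - id there; its 2-jet is then determined by the
symmetric bilinear map B = D^2 sigma (a). Differentiating the transported
tensor along a path whose velocity has base part v and fibre part r (the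
derivative of the matrix G of components) gives

    Psi (v, r) = (- v, r + G (B (v, .), .) + G (., B (v, .)))

[Psi_formula]. The (-1)-eigenspace is therefore a graph over the base
directions, and so is the image of the differential of h, which consists of
the pairs (v, D_v h). The two agree exactly when

    2 D_v h (X, Y) = - (h (B (v, X), Y) + h (X, B (v, Y)))

for all v, X, Y [Psi_eigenspaceP]. This says that - B / 2 is a torsion-free
metric connection at x, and the usual Koszul manipulation shows that the
equation has one and only one symmetric solution B, namely minus twice the
Christoffel symbols of h [koszul_unique, koszul_compatible]. Since B is
symmetric by the theorem of Schwarz [schwarz], this already gives uniqueness
of the jet.

For existence, every symmetric bilinear B has to be the second derivative of
a local diffeomorphism with differential - id. No inverse function theorem is
needed for that: the second derivatives that occur at a fixed point with
differential id are closed under addition (compose the diffeomorphisms), and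
the maps u |-> u + l(u)^2 / (1 - l(u) l(w)) w, for l a linear form, have the
second derivative 2 l (x) l w and are inverted by replacing w with - w
[shearK, germ_shear]. By polarization these tensors span [germ_symmetry].

It remains to see that the jets found at the various points, each built in
its own chart, form a smooth field. The equation that characterizes B is
invariant under changes of charts [change_compatible], so that by uniqueness
the second derivatives of all these symmetries in one fixed chart are again
given by the Koszul formula in that chart, an expression that is visibly
smooth in the base point [change_second_derivative, smooth_geodesic_field].
*)
(* The iteration lemma of ssrnat has the same short name. *)
Local Notation iterD := Defs.iterD.

(** * Smooth functions on open sets *)

(** Iterated derivatives taken from the inside out. With an open set fixed once
and for all, closure properties follow by induction on k, whereas smoothness
near a point would require one neighbourhood for all orders. *)
Fixpoint Ck {R : realType} {E F : normedModType R} (k : nat) (U : set E)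
    (f : E -> F) : Prop :=
  (forall u, U u -> differentiable f u) /\
  (if k is k'.+1 then forall v, Ck k' U ('D_v f) else True).

Section CkBasics.
Context {R : realType} {E F : normedModType R}.
Implicit Types (f g : E -> F) (U : set E) (k : nat).

Lemma Ck_diff k U f u : Ck k U f -> U u -> differentiable f u.
Proof. by case: k => [|k] [+ _]; apply. Qed.

Lemma Ck_derive k U f v : Ck k.+1 U f -> Ck k U ('D_v f).
Proof. by case=> _; apply. Qed.

Lemma CkS k U f : Ck k.+1 U f -> Ck k U f.
Proof.
elim: k f => [|k IH] f; first by case.
by case=> df dDf; split => // v; apply/IH/dDf.
Qed.

Lemma iterD_rcons vs v f : iterD (rcons vs v) f = iterD vs ('D_v f).
Proof. by rewrite /iterD foldr_rcons. Qed.

Lemma smooth_Ck U f :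
  (forall u, U u -> smooth_pt f u) <-> forall k, Ck k U f.
Proof.
split.
- move=> sf k; elim: k f sf => [|k IH] f sf; split=> //.
  + by move=> u /sf/(_ [::]).
  + by move=> u /sf/(_ [::]).
  + by move=> v; apply: IH => u Uu vs; rewrite -iterD_rcons; exact: sf.
- move=> Cf u Uu vs; elim/last_ind: vs f Cf => [|vs v IH] f Cf.
    exact: (Ck_diff (Cf 0%N)).
  by rewrite iterD_rcons; apply: IH => k; exact: Ck_derive.
Qed.

Lemma smooth_nearP f a : smooth_near f a <->
  exists U, [/\ open U, U a & forall k, Ck k U f].
Proof.
split.
- move=> /nbhs_interior.
  rewrite nbhsE => -[U [oU Ua] sU]; exists U; split => //.
  by apply/smooth_Ck => u /sU /interior_subset.
- move=> [U [oU Ua /smooth_Ck sU]].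
  by apply: filterS sU _; exact: open_nbhs_nbhs.
Qed.

Lemma eq_on_near f g U : open U -> (forall u, U u -> f u = g u) ->
  forall u, U u -> \forall z \near u, f z = g z.
Proof. by move=> oU fg u Uu; apply: filterS fg _; exact: open_nbhs_nbhs. Qed.

(** The differential is characterized by the usual estimate, which is stable under
modifications away from the point. *)
Lemma differentiable_eps f (L : {linear E -> F}) u : continuous L ->
  (forall e : R, 0 < e ->
     \forall h \near 0, `|f (h + u) - f u - L h| <= e * `|h|) ->
  differentiable f u /\ 'd f u = L :> (E -> F).
Proof.
move=> cL Hf.
have fL : f \o shift u = cst (f u) + L +o_ 0 id.
  apply/eqaddoP => e e0; near=> h => /=.
  rewrite opprD addrA.
  by near: h; exact: Hf.
have dL : 'd f u = L :> (E -> F) by apply: diff_unique.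
split=> //; apply/diff_locallyP; rewrite dL; split=> //.
Unshelve. all: by end_near. Qed.

Lemma diff_eps f u (e : R) : differentiable f u -> 0 < e ->
  \forall h \near 0, `|f (h + u) - f u - 'd f u h| <= e * `|h|.
Proof.
move=> /diff_locally/eqaddoP/[apply].
by apply: filterS => h /=; rewrite opprD addrA.
Qed.

Lemma near_eq_diff f g u :
  (\forall z \near u, f z = g z) -> differentiable f u ->
  differentiable g u /\ 'd g u = 'd f u :> (E -> F).
Proof.
move=> fg df; have fgu := nbhs_singleton fg.
apply: differentiable_eps => [|e e0]; first exact: diff_continuous.
have := near_shift 0 u; rewrite subr0 => /(_ (fun z => f z = g z)) fgE.
move: fg; rewrite fgE => fg.
near=> h.
have <- : f (h + u) = g (h + u) by near: h; exact: fg.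
by rewrite -fgu; near: h; exact: diff_eps.
Unshelve. all: by end_near. Qed.

Lemma near_eq_differentiable f g u :
  (\forall z \near u, f z = g z) -> differentiable f u -> differentiable g u.
Proof. by move=> fg /(near_eq_diff fg)[]. Qed.

Lemma Ck_eq k U f g : open U -> (forall u, U u -> f u = g u) ->
  Ck k U f -> Ck k U g.
Proof.
move=> oU; elim: k f g => [|k IH] f g fg Cf.
  split=> // u Uu; apply: near_eq_differentiable (Ck_diff Cf Uu).
  exact: eq_on_near fg _ Uu.
split=> [u Uu|v].
  apply: near_eq_differentiable (Ck_diff Cf Uu).
  exact: eq_on_near fg _ Uu.
apply: IH (Ck_derive v Cf) => u Uu.
apply: near_eq_derive; exact: eq_on_near fg _ Uu.
Qed.

Lemma Ck_sub k U V f : V `<=` U -> Ck k U f -> Ck k V f.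
Proof.
move=> VU; elim: k f => [|k IH] f [df Cf].
  by split=> // u /VU/df.
split=> [u /VU/df //|v]; exact: IH (Cf v).
Qed.

Lemma Ck_cst k U (c : F) : Ck k U (cst c).
Proof.
elim: k c => [|k IH] c; split=> // v.
by rewrite (_ : 'D_v _ = cst 0) //; apply/funext => u; rewrite derive_cst.
Qed.

Lemma CkD k U f g : open U -> Ck k U f -> Ck k U g -> Ck k U (f + g).
Proof.
move=> oU; elim: k f g => [|k IH] f g Cf Cg; split=> //.
- by move=> u Uu; apply: differentiableD; [exact: Ck_diff Cf _ | exact: Ck_diff Cg _].
- by move=> u Uu; apply: differentiableD; [exact: Ck_diff Cf _ | exact: Ck_diff Cg _].
move=> v; refine (Ck_eq oU _ (IH _ _ (Ck_derive v Cf) (Ck_derive v Cg))) => u Uu.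
by rewrite deriveD //; apply/diff_derivable; [exact: Ck_diff Cf _ | exact: Ck_diff Cg _].
Qed.

End CkBasics.

Section CkAlgebra.
Context {R : realType} {E : normedModType R}.
Implicit Types (U : set E) (k : nat).

Lemma Ck_comp_linear (F G : normedModType R) (L : {linear F -> G}) k U
    (f : E -> F) :
  continuous L -> open U -> Ck k U f -> Ck k U (L \o f : E -> G).
Proof.
move=> cL oU.
have dL f' u : differentiable f' u -> differentiable (L \o f') u.
  by move=> ?; apply: differentiable_comp => //; exact: linear_differentiable.
elim: k f => [|k IH] f Cf; split=> //.
- by move=> u /(Ck_diff Cf) /dL.
- by move=> u /(Ck_diff Cf) /dL.
move=> v; refine (Ck_eq oU _ (IH _ (Ck_derive v Cf))) => u Uu.
have df := Ck_diff Cf Uu.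
rewrite deriveE; last exact: dL.
rewrite diff_comp //; last exact: linear_differentiable.
by rewrite /= diff_lin // deriveE.
Qed.

Lemma Ck_sum (F : normedModType R) (I : Type) (r : seq I) (P : pred I)
    (f : I -> E -> F) k U : open U ->
  (forall i, P i -> Ck k U (f i)) ->
  Ck k U (fun u => \sum_(i <- r | P i) f i u).
Proof.
move=> oU Cf; elim: r => [|i r IH].
  rewrite (_ : (fun _ => _) = cst 0); first exact: Ck_cst.
  by apply/funext => u; rewrite big_nil.
have [Pi|/negPf Pi] := boolP (P i).
  rewrite (_ : (fun _ => _) = f i + (fun u => \sum_(i <- r | P i) f i u)).
    by apply: CkD => //; exact: Cf.
  by apply/funext => u; rewrite big_cons Pi.
rewrite (_ : (fun _ => _) = (fun u => \sum_(i <- r | P i) f i u)) //.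
by apply/funext => u; rewrite big_cons Pi.
Qed.

Lemma CkM k U (f g : E -> R) : open U -> Ck k U f -> Ck k U g -> Ck k U (f * g).
Proof.
move=> oU; elim: k f g => [|k IH] f g Cf Cg.
  split=> // u Uu; apply: differentiableM; [exact: Ck_diff Cf _ | exact: Ck_diff Cg _].
split=> [u Uu|v].
  by apply: differentiableM; [exact: Ck_diff Cf _ | exact: Ck_diff Cg _].
have H := CkD oU (IH _ _ (CkS Cf) (Ck_derive v Cg))
                 (IH _ _ (CkS Cg) (Ck_derive v Cf)).
refine (Ck_eq oU _ H) => u Uu.
by rewrite deriveM //; apply/diff_derivable; [exact: Ck_diff Cf _ | exact: Ck_diff Cg _].
Qed.

Lemma Ck_prod (I : Type) (r : seq I) (P : pred I) (f : I -> E -> R) k U :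
  open U -> (forall i, P i -> Ck k U (f i)) ->
  Ck k U (fun u => \prod_(i <- r | P i) f i u).
Proof.
move=> oU Cf; elim: r => [|i r IH].
  rewrite (_ : (fun _ => _) = cst 1); first exact: Ck_cst.
  by apply/funext => u; rewrite big_nil.
have [Pi|/negPf Pi] := boolP (P i).
  rewrite (_ : (fun _ => _) = f i * (fun u => \prod_(i <- r | P i) f i u)).
    by apply: CkM => //; exact: Cf.
  by apply/funext => u; rewrite big_cons Pi.
rewrite (_ : (fun _ => _) = (fun u => \prod_(i <- r | P i) f i u)) //.
by apply/funext => u; rewrite big_cons Pi.
Qed.

Lemma CkN k U (f : E -> R) : open U -> Ck k U f -> Ck k U (fun u => - f u).
Proof.
move=> oU Cf; rewrite (_ : (fun _ => _) = cst (-1) * f).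
  by apply: CkM => //; exact: Ck_cst.
by apply/funext => u; rewrite mulrfctE mulN1r.
Qed.

Lemma CkV k U (f : E -> R) : open U -> (forall u, U u -> f u != 0) ->
  Ck k U f -> Ck k U (fun u => (f u)^-1).
Proof.
move=> oU f0; elim: k => [|k IH] Cf.
  by split=> // u Uu; apply: differentiableV; [exact: Ck_diff Cf _ | exact: f0].
split=> [u Uu|v].
  by apply: differentiableV; [exact: Ck_diff Cf _ | exact: f0].
have H := CkN oU (CkM oU (CkM oU (IH (CkS Cf)) (IH (CkS Cf))) (Ck_derive v Cf)).
refine (Ck_eq oU _ H) => u Uu.
rewrite deriveV ?f0 //; last by apply/diff_derivable; exact: Ck_diff Cf _.
by rewrite mulrfctE scaleNr /= -exprVn expr2.
Qed.

Lemma differentiable_mxP m n (f : E -> 'M[R]_(m, n)) u :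
  differentiable f u <-> forall i j, differentiable (fun z => f z i j) u.
Proof.
split=> [df i j|df].
  exact: (@differentiable_comp _ _ _ _ f (fun N : 'M[R]_(m, n) => N i j : R)
    u df (differentiable_coord _ _ _)).
have -> : f = \sum_(i < m) \sum_(j < n) (fun z => f z i j *: delta_mx i j).
  apply/funext => z; rewrite [LHS]matrix_sum_delta fct_sumE.
  by apply: eq_bigr => i _; rewrite fct_sumE.
by apply: differentiable_sum => i; apply: differentiable_sum => j; exact: differentiableZl.
Qed.

Lemma derive_coord m n (f : E -> 'M[R]_(m, n)) u v i j : differentiable f u ->
  ('D_v f u) i j = 'D_v (fun z => f z i j) u.
Proof. by move=> df; rewrite derive_mx ?mxE //; exact/diff_derivable. Qed.

Lemma Ck_mxP m n k U (f : E -> 'M[R]_(m, n)) : open U ->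
  Ck k U f <-> forall i j, Ck k U (fun z => f z i j).
Proof.
move=> oU; elim: k f => [|k IH] f.
  split=> [Cf i j|Cf]; split=> // u Uu.
    by move: i j; apply/differentiable_mxP; exact: Ck_diff Cf _.
  by apply/differentiable_mxP => i j; exact: Ck_diff (Cf i j) _.
split=> [Cf i j|Cf].
  have df u : U u -> differentiable f u by exact: Ck_diff Cf.
  split=> [u /df/differentiable_mxP //|v].
  have /IH Cv := Ck_derive v Cf.
  refine (Ck_eq oU _ (Cv i j)) => u Uu.
  by rewrite derive_coord //; exact: df.
have df u : U u -> differentiable f u.
  by move=> Uu; apply/differentiable_mxP => i j; exact: Ck_diff (Cf i j) _.
split=> // v; apply/IH => i j.
refine (Ck_eq oU _ (Ck_derive v (Cf i j))) => u Uu.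
by rewrite derive_coord //; exact: df.
Qed.

Lemma Ck_mulmx m n p k U (f : E -> 'M[R]_(m, n)) (g : E -> 'M[R]_(n, p)) :
  open U -> Ck k U f -> Ck k U g -> Ck k U (fun u => f u *m g u).
Proof.
move=> oU /(Ck_mxP _ _ oU) Cf /(Ck_mxP _ _ oU) Cg; apply/Ck_mxP => // i j.
rewrite (_ : (fun _ => _) = fun u => \sum_k (f u i k * g u k j)).
  by apply: Ck_sum => // l _; exact: CkM (Cf i l) (Cg l j).
by apply/funext => u; rewrite mxE.
Qed.

Lemma Ck_det n k U (f : E -> 'M[R]_n) :
  open U -> Ck k U f -> Ck k U (fun u => \det (f u)).
Proof.
move=> oU /(Ck_mxP _ _ oU) Cf; rewrite /determinant.
apply: Ck_sum => // s _; apply: CkM => //; first exact: Ck_cst.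
by apply: Ck_prod => // i _; exact: Cf.
Qed.

(** Cramer's rule makes the inverse a quotient of polynomials in the entries. *)
Lemma Ck_invmx n k U (f : E -> 'M[R]_n) : open U ->
  (forall u, U u -> f u \in unitmx) -> Ck k U f -> Ck k U (fun u => invmx (f u)).
Proof.
move=> oU f1 Cf; apply/Ck_mxP => // i j.
have H : Ck k U (fun u => (\det (f u))^-1 * cofactor (f u) j i).
  apply: CkM => //.
    apply: CkV => //; last exact: Ck_det.
    by move=> u /f1; rewrite unitmxE unitfE.
  apply: CkM => //; first exact: Ck_cst.
  apply: Ck_det => //; apply/Ck_mxP => // i' j'.
  rewrite (_ : (fun _ => _) = fun u => f u (lift j i') (lift i j')).
    by move/(Ck_mxP _ _ oU) : Cf; apply.
  by apply/funext => u; rewrite !mxE.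
refine (Ck_eq oU _ H) => u Uu.
by rewrite /invmx f1 // !mxE.
Qed.

End CkAlgebra.

Section Composition.
Context {R : realType} {E : normedModType R}.

Lemma derive_comp (F G : normedModType R) (f : F -> G) (g : E -> F) u v :
  differentiable g u -> differentiable f (g u) ->
  'D_v (f \o g) u = 'D_('D_v g u) f (g u).
Proof.
move=> dg df; rewrite deriveE; last exact: differentiable_comp.
by rewrite diff_comp //= -!deriveE.
Qed.

Lemma derive_row_sum m (F : normedModType R) (f : 'rV[R]_m -> F) a v :
  differentiable f a ->
  'D_v f a = \sum_i v 0 i *: 'D_(delta_mx 0 i) f a.
Proof.
move=> df; rewrite deriveE // {1}[v]row_sum_delta linear_sum.
by apply: eq_bigr => i _; rewrite linearZ deriveE.
Qed.

(** The chain rule writes a derivative of f o g as a sum of products of derivatives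
of g with derivatives of f composed with g, of one order less, so that the
induction closes. *)
Lemma Ck_comp m p q k (V : set 'rV[R]_m) (U : set E)
    (f : 'rV[R]_m -> 'M[R]_(p, q)) (g : E -> 'rV[R]_m) :
  open V -> open U -> (forall u, U u -> V (g u)) -> Ck k V f -> Ck k U g ->
  Ck k U (f \o g).
Proof.
move=> oV oU UV /(Ck_mxP _ _ oV) Cf Cg; apply/Ck_mxP => // i j.
have -> : (fun u => (f \o g) u i j) = (fun z => f z i j) \o g by [].
move: {f Cf} (fun z => f z i j) (Cf i j) => h Ch.
elim: k h g UV Ch Cg => [|k IH] h g UV Ch Cg.
  split=> // u Uu; apply: differentiable_comp; first exact: Ck_diff Cg _.
  by apply: Ck_diff Ch _; exact: UV.
split=> [u Uu|v].
  apply: differentiable_comp; first exact: Ck_diff Cg _.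
  by apply: Ck_diff Ch _; exact: UV.
have H : Ck k U (fun u => \sum_i ('D_v g u) 0 i * 'D_(delta_mx 0 i) h (g u)).
  apply: Ck_sum => // l _.
  apply: (@CkM _ _ k U (fun u => ('D_v g u) 0 l)) => //.
    exact: ((Ck_mxP k ('D_v g : E -> 'rV_m) oU).1 (Ck_derive v Cg) 0 l).
  exact: (IH ('D_(delta_mx 0 l) h) g UV (Ck_derive _ Ch) (CkS Cg)).
refine (Ck_eq oU _ H) => u Uu.
have dh : differentiable h (g u) by apply: Ck_diff Ch _; exact: UV.
by rewrite [RHS]derive_comp //; [rewrite derive_row_sum | exact: Ck_diff Cg _].
Qed.

End Composition.

(** * Second derivatives *)
Section Schwarz.
Context {R : realType} {E : normedModType R}.
Implicit Types (f : E -> R) (a v w : E).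

Lemma near_normP a (P : E -> Prop) : (\forall u \near a, P u) ->
  exists2 d : R, 0 < d & forall h, `|h| < d -> P (h + a).
Proof.
move=> /nbhs_normP[d d0 Hd]; exists d => // h hd; apply: Hd => /=.
by rewrite opprD addrCA subrr addr0 normrN.
Qed.

Lemma is_derive_line f v b (s : R) : differentiable f (s *: v + b) ->
  is_derive s 1 (fun t : R => f (t *: v + b)) ('D_v f (s *: v + b)).
Proof.
move=> df.
have [dg1 dg2] : is_diff s (fun t : R => t *: v + b) ( *:%R ^~ v).
  have -> : (fun t : R => t *: v + b) = ( *:%R ^~ v) + cst b by [].
  by apply: is_diff_eq; rewrite addr0.
have dfg : differentiable (f \o (fun t : R => t *: v + b)) s.
  by apply: differentiable_comp.
apply: DeriveDef; first exact/diff_derivable.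
rewrite deriveE // diff_comp //=.
by rewrite dg2 scale1r deriveE.
Qed.

(** The mean value theorem in the direction v turns the second difference into a
difference of first derivatives, and the differentiability of D_v f at a then
makes it t^2 D_w (D_v f) (a) up to o(t^2). *)
Lemma second_difference f a v w (e : R) : 0 < e ->
  (\forall u \near a, differentiable f u) -> differentiable ('D_v f) a ->
  exists2 d : R, 0 < d & forall t, 0 < t < d ->
    `|f (t *: v + (t *: w + a)) - f (t *: w + a) - (f (t *: v + a) - f a)
      - t ^+ 2 * 'D_w ('D_v f) a| <= e * t ^+ 2.
Proof.
move=> e0 df dDf.
pose e' := e / (2 * `|v| + `|w| + 1).
have K0 : 0 < 2 * `|v| + `|w| + 1.
  by rewrite ltr_wpDl // addr_ge0 // mulr_ge0.
have e'0 : 0 < e' by rewrite divr_gt0.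
have [d1 d10 Hd1] := near_normP df.
have := near_normP; move=> /(_ 0) /(_ _ (diff_eps dDf e'0))[d2 d20 Hd2].
exists (Num.min d1 d2 / (`|v| + `|w| + 1)).
  by rewrite divr_gt0 ?lt_min ?d10 //= ltr_wpDl // addr_ge0.
move=> t /andP[t0]; rewrite ltr_pdivlMr; last by rewrite ltr_wpDl // addr_ge0.
rewrite lt_min => /andP[td1 td2].
have small (c x : R) : 0 <= c <= t -> 0 <= x <= t ->
    `|c *: v + x *: w| < t * (`|v| + `|w| + 1).
  move=> /andP[c0 ct] /andP[x0 xt].
  apply: (@le_lt_trans _ _ (t * (`|v| + `|w|))); last first.
    by rewrite ltr_pM2l // ltrDl.
  rewrite (le_trans (ler_normD _ _)) // !normrZ !ger0_norm // mulrDr.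
  by rewrite lerD // ler_wpM2r.
have dfl (c x : R) : 0 <= c <= t -> 0 <= x <= t ->
    differentiable f (c *: v + (x *: w + a)).
  by move=> ct xt; rewrite addrA; apply/Hd1/(lt_trans (small _ _ ct xt)).
have tt : 0 <= t <= t by rewrite ltW //=.
have oo : 0 <= (0 : R) <= t by rewrite lexx /= ltW.
pose g (s : R) := f (s *: v + (t *: w + a)) - f (s *: v + a).
pose dg (s : R) := 'D_v f (s *: v + (t *: w + a)) - 'D_v f (s *: v + a).
have dgE (s : R) : 0 <= s <= t -> is_derive s 1 g (dg s).
  move=> st; apply: is_deriveB; apply: is_derive_line; first exact: dfl.
  by have := dfl _ _ st oo; rewrite scale0r add0r.
have [c] : exists2 c, c \in `]0, t[%R & g t - g 0 = dg c * (t - 0).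
  apply: MVT => //.
    by move=> s; rewrite in_itv /= => /andP[s0 st]; apply: dgE; rewrite !ltW.
  apply: derivable_within_continuous => s; rewrite in_itv /= => st.
  by have [] := dgE _ st.
rewrite in_itv /= => /andP[c0 ct]; rewrite /g /dg !scale0r !add0r subr0.
have cc : 0 <= c <= t by rewrite !ltW.
move=> gE.
have -> : f (t *: v + (t *: w + a)) - f (t *: w + a) - (f (t *: v + a) - f a) =
   f (t *: v + (t *: w + a)) - f (t *: v + a) - (f (t *: w + a) - f a).
  by rewrite !opprB; ring.
rewrite gE.
have H1 := Hd2 _ (lt_trans (small _ _ cc tt) td2).
have H2 := Hd2 _ (lt_trans (small _ _ cc oo) td2).
move: H1 H2; rewrite !addr0 scale0r addr0 addrA.
set A := 'D_v f (_ + a); set B := 'D_v f (_ + a).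
have -> : t ^+ 2 * 'D_w ('D_v f) a =
   ('d ('D_v f) a (c *: v + t *: w) - 'd ('D_v f) a (c *: v)) * t.
  by rewrite (deriveE _ dDf) linearD addrC addKr linearZ /= expr2 -mulrA mulrC.
set LA := 'd _ _ (_ + _); set LB := 'd _ _ _; set C := 'D_v f a => H1 H2.
rewrite -mulrBl normrM (gtr0_norm t0) expr2 mulrA ler_pM2r //.
have -> : A - B - (LA - LB) = (A - C - LA) - (B - C - LB) by ring.
rewrite (le_trans (ler_normB _ _)) // (le_trans (lerD H1 H2)) //.
rewrite -mulrDr.
have -> : e * t = e' * (t * (2 * `|v| + `|w| + 1)).
  by rewrite /e' [RHS]mulrCA divfK ?gt_eqF // mulrC.
rewrite ler_pM2l // (le_trans (lerD (ler_normD _ _) (lexx _))) //.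
rewrite !normrZ (gtr0_norm t0) (gtr0_norm c0).
have : c * `|v| <= t * `|v| by rewrite ler_wpM2r // ltW.
nra.
Qed.

(** The second difference is symmetric in v and w, and both iterated derivatives
are its limit after division by t^2. *)
Lemma schwarz f a v w :
  (\forall u \near a, differentiable f u) ->
  differentiable ('D_v f) a -> differentiable ('D_w f) a ->
  'D_w ('D_v f) a = 'D_v ('D_w f) a.
Proof.
move=> df dv dw; apply/eqP; rewrite -subr_eq0 -normr_le0.
apply/ler_addgt0Pr => e e0; rewrite add0r.
have e20 : 0 < e / 2 by rewrite divr_gt0.
have [d1 d10 H1] := second_difference w e20 df dv.
have [d2 d20 H2] := second_difference v e20 df dw.
pose t := Num.min d1 d2 / 2.
have m0 : 0 < Num.min d1 d2 by rewrite lt_min d10.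
have t0 : 0 < t by rewrite divr_gt0.
have tm : t < Num.min d1 d2 by rewrite /t; lra.
move: (tm); rewrite lt_min => /andP[td1 td2].
have {}H1 := H1 t; rewrite t0 td1 in H1; have {}H1 := H1 isT.
have {}H2 := H2 t; rewrite t0 td2 in H2; have {}H2 := H2 isT.
have t20 : 0 < t ^+ 2 by rewrite exprn_gt0.
rewrite -(ler_pM2r t20) -{1}(gtr0_norm t20) -normrM.
move: H1 H2; rewrite (addrCA (t *: w)).
set P := f (_ + _); set A := 'D_w _ _; set B := 'D_v _ _ => H1 H2.
set Q := f (_ + _) in H1 H2; set S := f (_ + _) in H1 H2.
have -> : (A - B) * t ^+ 2 =
  (P - S - (Q - f a) - t ^+ 2 * B) - (P - Q - (S - f a) - t ^+ 2 * A) by ring.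
rewrite (le_trans (ler_normB _ _)) // (le_trans (lerD H2 H1)) //.
by rewrite -mulrDl -splitr.
Qed.

End Schwarz.

Section SecondDerivative.
Context {R : realType} {E : normedModType R}.

Lemma eq_on_derive (F : normedModType R) (f g : E -> F) U a v :
  open U -> U a -> (forall u, U u -> f u = g u) -> 'D_v f a = 'D_v g a.
Proof.
move=> oU Ua fg; apply: near_eq_derive.
by apply: filterS fg _; exact: open_nbhs_nbhs.
Qed.

Lemma derive_lin (F : normedModType R) (f : E -> F) a (c : R) v w :
  differentiable f a ->
  'D_(c *: v + w) f a = c *: 'D_v f a + 'D_w f a.
Proof. by move=> df; rewrite !deriveE // linearP. Qed.

Lemma derive2_coord p q (f : E -> 'M[R]_(p, q)) U a v w i j :
  open U -> U a -> Ck 2 U f ->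
  ('D_v ('D_w f) a) i j = 'D_v ('D_w (fun z => f z i j)) a.
Proof.
move=> oU Ua Cf; rewrite derive_coord; last exact: Ck_diff (Ck_derive w Cf) _.
apply: (eq_on_derive _ oU Ua) => u Uu.
by rewrite derive_coord //; exact: Ck_diff Cf _.
Qed.

Lemma derive2_sym p q (f : E -> 'M[R]_(p, q)) U a v w :
  open U -> U a -> Ck 2 U f -> 'D_v ('D_w f) a = 'D_w ('D_v f) a.
Proof.
move=> oU Ua Cf; apply/matrixP => i j.
apply: (etrans (derive2_coord v w i j oU Ua Cf)).
apply: (etrans _ (esym (derive2_coord w v i j oU Ua Cf))).
have {}Cf := (Ck_mxP _ _ oU).1 Cf i j.
apply: schwarz.
- apply: (@filterS _ _ _ U) => [u Uu|]; last exact: open_nbhs_nbhs.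
  exact: Ck_diff Cf _.
- exact: Ck_diff (Ck_derive w Cf) _.
- exact: Ck_diff (Ck_derive v Cf) _.
Qed.

End SecondDerivative.

Section SecondDerivativeComp.
Context {R : realType} {E : normedModType R}.

Lemma derive2_comp m p q (V : set 'rV[R]_m) (U : set E)
    (f : 'rV[R]_m -> 'M[R]_(p, q)) (g : E -> 'rV[R]_m) a v w :
  open V -> open U -> (forall u, U u -> V (g u)) -> Ck 2 V f -> Ck 2 U g ->
  U a ->
  'D_v ('D_w (f \o g)) a =
    'D_('D_v g a) ('D_('D_w g a) f) (g a) + 'D_('D_v ('D_w g) a) f (g a).
Proof.
move=> oV oU UV Cf Cg Ua; apply/matrixP => i j.
have Cfg := Ck_comp oV oU UV Cf Cg.
have Vga := UV _ Ua.
apply: (etrans (derive2_coord v w i j oU Ua Cfg)).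
rewrite [RHS]mxE.
have -> := derive2_coord ('D_v g a) ('D_w g a) i j oV Vga Cf.
rewrite derive_coord; last exact: Ck_diff Cf _.
have -> : (fun z => (f \o g) z i j) = (fun z => f z i j) \o g by [].
move: {f Cf Cfg} (fun z => f z i j) ((Ck_mxP _ _ oV).1 Cf i j) => f Cf.
have df u : U u -> differentiable f (g u) by move=> /UV; exact: Ck_diff Cf.
have dDf x u : U u -> differentiable ('D_x f) (g u).
  by move=> /UV; exact: Ck_diff (Ck_derive x Cf).
have dg u : U u -> differentiable g u by exact: Ck_diff Cg.
have dDg x u : U u -> differentiable ('D_x g) u by exact: Ck_diff (Ck_derive x Cg).
pose h l : E -> R := (fun u => ('D_w g u) 0 l) * ('D_(delta_mx 0 l) f \o g).
rewrite (eq_on_derive (g := \sum_l h l) v oU Ua); last first.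
  move=> u Uu; rewrite [LHS]derive_comp //; [|exact: dg|exact: df].
  by rewrite derive_row_sum ?fct_sumE //; exact: df.
have dc l : differentiable (fun u => ('D_w g u) 0 l) a.
  by move: 0 l; apply/differentiable_mxP; exact: dDg.
have dfc l : differentiable ('D_(delta_mx 0 l) f \o g) a.
  by apply: differentiable_comp; [exact: dg | exact: dDf].
rewrite derive_sum; last first.
  by move=> l; apply/derivableM; exact/diff_derivable.
rewrite [X in _ = X + _](_ : _ = \sum_l ('D_w g a) 0 l *
    'D_('D_v g a) ('D_(delta_mx 0 l) f) (g a)); last first.
  have dDl l : derivable (('D_w g a) 0 l \*: 'D_(delta_mx 0 l) f) (g a) ('D_v g a).
    by apply/derivableZ/diff_derivable; exact: dDf.
  rewrite (@near_eq_derive _ _ _ _ (\sum_l ('D_w g a) 0 l \*: 'D_(delta_mx 0 l) f)).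
    rewrite derive_sum //; apply: eq_bigr => l _.
    by rewrite deriveZ //; apply/diff_derivable; exact: dDf.
  apply: (@filterS _ _ _ V); last exact: open_nbhs_nbhs.
  move=> u Vu /=; rewrite derive_row_sum ?fct_sumE //; exact: Ck_diff Cf _.
rewrite [X in _ = _ + X]derive_row_sum; last exact: df.
rewrite -big_split; apply: eq_bigr => l _ /=.
rewrite deriveM; [|exact/diff_derivable..].
have e1 : 'D_v ('D_(delta_mx 0 l) f \o g) a =
    'D_('D_v g a) ('D_(delta_mx 0 l) f) (g a).
  exact: (derive_comp v (dg _ Ua) (dDf _ _ Ua)).
have e2 := derive_coord v 0 l (dDg w _ Ua).
rewrite e1 -e2; congr (_ + _); exact: mulrC.
Qed.

End SecondDerivativeComp.

Lemma open_setI_preimage (S T : topologicalType) (f : S -> T) (U : set S)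
    (V : set T) : open U -> open V -> (forall u, U u -> {for u, continuous f}) ->
  open (U `&` f @^-1` V).
Proof.
move=> oU oV cf; rewrite openE => u [Uu Vfu].
apply: filterI; first exact: open_nbhs_nbhs.
by apply: cf Uu _ _; exact: open_nbhs_nbhs.
Qed.

Section AffineAndProducts.
Context {R : realType}.

Lemma Ck_affine (E F : normedModType R) (f : E -> F) (L : {linear E -> F}) (c : F) :
  (forall u, f u = L u + c) -> continuous L ->
  forall k, Ck k setT f /\ (forall v, 'D_v f = cst (L v)).
Proof.
move=> fE cL k.
have df u : differentiable f u /\ 'd f u = L :> (E -> F).
  apply: differentiable_eps => // e e0; near=> h.
  by rewrite !fE linearD opprD addrACA subrr addr0 addrK subrr normr0 mulr_ge0 // ltW.
have Df v : 'D_v f = cst (L v).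
  by apply/funext => u; rewrite deriveE ?(df u).2 //; exact: (df u).1.
split=> //; case: k => [|k]; first by split=> // u _; exact: (df u).1.
split=> [u _|v]; first exact: (df u).1.
by rewrite Df; exact: Ck_cst.
Unshelve. all: by end_near. Qed.

Lemma derive_scalel (E F : normedModType R) (q : E -> R) (w : F) u v :
  differentiable q u -> 'D_v (fun z => q z *: w) u = 'D_v q u *: w.
Proof.
move=> dq; rewrite deriveE; last exact: differentiableZl.
by rewrite diffZl // deriveE.
Qed.

(** In the Leibniz formula only the cross terms survive when both factors vanish. *)
Lemma derive2_mul0 (E : normedModType R) (p s : E -> R) U a v w :
  open U -> U a -> Ck 2 U p -> Ck 2 U s -> p a = 0 -> s a = 0 ->
  'D_v ('D_w (p * s)) a = 'D_v p a * 'D_w s a + 'D_w p a * 'D_v s a.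
Proof.
move=> oU Ua Cp Cs pa sa.
have dp x u : U u -> derivable p u x by move=> Uu; apply/diff_derivable; exact: Ck_diff Cp _.
have ds x u : U u -> derivable s u x by move=> Uu; apply/diff_derivable; exact: Ck_diff Cs _.
have dDp x y : derivable ('D_x p) a y.
  by apply/diff_derivable; exact: Ck_diff (Ck_derive x Cp) _.
have dDs x y : derivable ('D_x s) a y.
  by apply/diff_derivable; exact: Ck_diff (Ck_derive x Cs) _.
rewrite (eq_on_derive (g := p * 'D_w s + s * 'D_w p) v oU Ua); last first.
  by move=> u Uu; rewrite deriveM //; [exact: dp|exact: ds].
rewrite deriveD; [|apply: derivableM => //; exact: dp|apply: derivableM => //; exact: ds].
rewrite !deriveM //; [|exact: ds|exact: dp].
rewrite pa sa.
move: ('D_v ('D_w s) a) ('D_v ('D_w p) a) ('D_w s a) ('D_v p a) ('D_w p a) ('D_v s a).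
move=> x1 x2 x3 x4 x5 x6; rewrite !scale0r !add0r; congr (_ + _); exact: mulrC.
Qed.

End AffineAndProducts.

(** * Local diffeomorphisms with a prescribed 2-jet *)
Section SymmetricBilinear.
Context {R : realType} {n : nat}.
Implicit Types (v w : 'rV[R]_n) (B : 'rV[R]_n -> 'rV[R]_n -> 'rV[R]_n).

Definition sym_bilinear B :=
  (forall v w, B v w = B w v) /\
  (forall (c : R) u v w, B (c *: u + v) w = c *: B u w + B v w).

Lemma bilinear_scalel B (c : R) v w : sym_bilinear B -> B (c *: v) w = c *: B v w.
Proof.
move=> [_ Bl]; have B0l : B 0 w = 0.
  by have := Bl (-1) 0 0 w; rewrite scaler0 addr0 scaleN1r addNr.
by have := Bl c v 0 w; rewrite B0l !addr0.
Qed.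

Lemma bilinear_opp B v w : sym_bilinear B -> B (- v) (- w) = B v w.
Proof.
move=> Bb; rewrite -scaleN1r bilinear_scalel // Bb.1 -[- w]scaleN1r.
by rewrite bilinear_scalel // scalerA mulrNN mulr1 scale1r Bb.1.
Qed.

Lemma bilinear_suml B (I : Type) (r : seq I) (F : I -> 'rV[R]_n) w :
  sym_bilinear B -> B (\sum_(i <- r) F i) w = \sum_(i <- r) B (F i) w.
Proof.
move=> Bb; elim/big_rec2 : _ => [|i x y _ <-].
  by have := bilinear_scalel 0 0 w Bb; rewrite !scale0r.
by have := Bb.2 1 (F i) y w; rewrite !scale1r.
Qed.

Lemma sym_bilinear_sum B v w : sym_bilinear B ->
  B v w = \sum_a \sum_i (v 0 a * w 0 i) *: B (delta_mx 0 a) (delta_mx 0 i).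
Proof.
move=> Bb; rewrite {1}[v]row_sum_delta bilinear_suml //.
apply: eq_bigr => i _; rewrite bilinear_scalel // Bb.1 {1}[w]row_sum_delta.
rewrite bilinear_suml // scaler_sumr; apply: eq_bigr => j _.
by rewrite bilinear_scalel // scalerA Bb.1.
Qed.

End SymmetricBilinear.

Section Germs.
Context {R : realType} {n : nat}.
Local Notation V := 'rV[R]_n.
Implicit Types (u v w : V) (B : V -> V -> V).

(** Germs of diffeomorphisms from a to b, with a chosen representative of the
inverse. The two open sets are exchanged by f and g, which makes f a
diffeomorphism between them and spares an inverse function theorem. *)
Definition germ (a b : V) (L : V -> V) B := exists (f g : V -> V) (U W : set V),
  [/\ [/\ open U, U a, open W & W b], f a = b,
      [/\ forall k, Ck k U f, forall k, Ck k W g,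
          forall u, U u -> W (f u) /\ g (f u) = u &
          forall w, W w -> U (g w) /\ f (g w) = w],
      forall v, 'D_v f a = L v & forall v w, 'D_v ('D_w f) a = B v w].

Lemma continuous_Ck (F : normedModType R) (f : V -> F) U u :
  (forall k, Ck k U f) -> U u -> {for u, continuous f}.
Proof. by move=> Cf Uu; apply: differentiable_continuous; exact: Ck_diff (Cf 0%N) _. Qed.

(** Any pair of mutually inverse smooth maps can be cut down to open sets that they
exchange, inside prescribed neighbourhoods. *)
Lemma germ_shrink (a b : V) L B (f g : V -> V) (U W : set V) :
  open U -> U a -> open W -> W b -> f a = b ->
  (forall k, Ck k U f) -> (forall k, Ck k W g) ->
  (forall u, U u -> g (f u) = u) -> (forall w, W w -> f (g w) = w) ->
  (forall v, 'D_v f a = L v) -> (forall v w, 'D_v ('D_w f) a = B v w) ->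
  forall O O' : set V, open O -> open O' -> O a -> O' b ->
  exists U' W' : set V, [/\ U' `<=` U `&` O, W' `<=` W `&` O',
    [/\ open U', U' a, open W' & W' b] &
    (forall u, U' u -> W' (f u) /\ g (f u) = u) /\
    (forall w, W' w -> U' (g w) /\ f (g w) = w)].
Proof.
move=> oU Ua oW Wb fab Cf Cg gf fg Df DDf O O' oO oO' Oa O'b.
exists ((U `&` O) `&` f @^-1` (W `&` O')), ((W `&` O') `&` g @^-1` (U `&` O)).
have gba : g b = a by rewrite -fab gf.
split; [by move=> ? []|by move=> ? []| |].
  split; [| |apply: open_setI_preimage|]; rewrite /= ?gba ?fab //.
  - apply: open_setI_preimage; [exact: openI|exact: openI|].
    by move=> u [Uu _]; exact: continuous_Ck Cf Uu.
  - exact: openI.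
  - exact: openI.
  - by move=> u [Uu _]; exact: continuous_Ck Cg Uu.
split=> [u [[Uu Ou] [Wu O'u]]|w [[Ww O'w] [Uw Ow]]].
  by rewrite /= gf.
by rewrite /= fg.
Qed.

Lemma germ_restrict a b L B (O O' : set V) : open O -> open O' -> O a -> O' b ->
  germ a b L B ->
  exists (f g : V -> V) (U W : set V),
  [/\ [/\ open U, U a, open W & W b], f a = b,
      [/\ forall k, Ck k U f, forall k, Ck k W g,
          forall u, U u -> W (f u) /\ g (f u) = u &
          forall w, W w -> U (g w) /\ f (g w) = w],
      (forall v, 'D_v f a = L v) /\ (forall v w, 'D_v ('D_w f) a = B v w) &
      U `<=` O /\ W `<=` O'].
Proof.
move=> oO oO' Oa O'b [f [g [U [W [[oU Ua oW Wb] fab [Cf Cg gf fg] Df DDf]]]]].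
have gf' u : U u -> g (f u) = u by move=> /gf[].
have fg' w : W w -> f (g w) = w by move=> /fg[].
have [U' [W' [U'U W'W [oU' U'a oW' W'b] [gf1 fg1]]]] :=
  germ_shrink oU Ua oW Wb fab Cf Cg gf' fg' Df DDf oO oO' Oa O'b.
exists f, g, U', W'; split=> //; last by split=> ? => [/U'U[]|/W'W[]].
split=> // k; [apply: Ck_sub (Cf k)|apply: Ck_sub (Cg k)] => u.
  by move=> /U'U[].
by move=> /W'W[].
Qed.

(** With L = L' = id the second derivatives add up, which is what allows one to build
them from simple ones. *)
Lemma germ_comp a b c L L' B B' : germ a b L B -> germ b c L' B' ->
  germ a c (L' \o L) (fun v w => B' (L v) (L w) + L' (B v w)).
Proof.
move=> G1 G2.
have [f2 [g2 [U2 [W2 [[oU2 U2b oW2 W2c] f2b [Cf2 Cg2 gf2 fg2] D2 DD2]]]]] := G2.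
have [f1 [g1 [U1 [W1 [[oU1 U1a oW1 W1b] f1a [Cf1 Cg1 gf1 fg1] [D1 DD1] [_ WU]]]]]] :=
  germ_restrict openT oU2 I U2b G1.
have [U' [W' [U'U W'W [oU' U'b oW' W'c] [gf3 fg3]]]] :=
  germ_shrink oU2 U2b oW2 W2c f2b Cf2 Cg2 (fun u h => (gf2 u h).2)
    (fun w h => (fg2 w h).2) D2 DD2 oW1 openT W1b I.
exists (f2 \o f1), (g1 \o g2), (U1 `&` f1 @^-1` U'), W'.
have oU : open (U1 `&` f1 @^-1` U').
  by apply: open_setI_preimage => // u Uu; exact: continuous_Ck Cf1 Uu.
have Ua : (U1 `&` f1 @^-1` U') a by split=> //=; rewrite f1a.
split=> //.
- by rewrite /= f1a f2b.
- split=> [k|k|u [Uu Ufu]|w Ww].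
  + apply: (Ck_comp oU2) => //; first by move=> u [_ /U'U[]].
    by apply: Ck_sub (Cf1 k) => u [].
  + apply: (Ck_comp oW1) => //; first by move=> u /fg3[/U'U[]].
    by apply: Ck_sub (Cg2 k) => u /W'W[].
  + have [h1 h2] := gf3 _ Ufu; have [h3 h4] := gf1 _ Uu.
    by split=> //=; rewrite h2.
  + have [h1 h2] := fg3 _ Ww.
    have [_ W1g] := U'U _ h1.
    have [h3 h4] := fg1 _ W1g.
    by split=> /=; rewrite ?h4 //; split=> //=; rewrite h4.
- move=> v; have df1 := Ck_diff (Cf1 0%N) U1a.
  have df2 : differentiable f2 (f1 a) by rewrite f1a; exact: Ck_diff (Cf2 0%N) U2b.
  by rewrite (derive_comp v df1 df2) D1 f1a D2.
- move=> v w.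
  have UW u : U1 u -> U2 (f1 u) by move=> /gf1[/WU].
  apply: (etrans (derive2_comp v w oU2 oU1 UW (Cf2 2%N) (Cf1 2%N) U1a)).
  by rewrite !D1 DD1 f1a DD2 D2.
Qed.

Lemma germ_ext a b L L' B B' : (forall v, L v = L' v) ->
  (forall v w, B v w = B' v w) -> germ a b L B -> germ a b L' B'.
Proof.
move=> LL BB [f [g [U [W [h1 h2 h3 h4 h5]]]]]; exists f, g, U, W; split => //.
  by move=> v; rewrite h4.
by move=> v w; rewrite h5.
Qed.

Lemma germ_translation a b : germ a b id (fun _ _ => 0).
Proof.
have [C1 D1] := all_and2 (@Ck_affine _ _ _ (fun u => u + (b - a)) idfun (b - a)
  (fun u => erefl) (fun u => cvg_id)).
have [C2 D2] := all_and2 (@Ck_affine _ _ _ (fun u => u + (a - b)) idfun (a - b)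
  (fun u => erefl) (fun u => cvg_id)).
exists (fun u => u + (b - a)), (fun u => u + (a - b)), setT, setT.
split.
- by split=> //; exact: openT.
- by rewrite addrC subrK.
- by split=> // [u _|w _]; split=> //; rewrite -addrA -opprB ?addNr ?subrr addr0.
- by move=> v; exact: (congr1 (fun g : V -> V => g a) (D1 0%N v)).
- move=> v w; apply: (etrans (congr1 (fun g : V -> V => 'D_v g a) (D1 0%N w))).
  exact: derive_cst.
Qed.

Lemma germ_opp a : germ a a -%R (fun _ _ => 0).
Proof.
have [C1 D1] := all_and2 (@Ck_affine _ _ _ (fun u : V => - u + (a + a)) -%R (a + a)
  (fun u => erefl) opp_continuous).
exists (fun u => - u + (a + a)), (fun u => - u + (a + a)), setT, setT.
split.
- by split=> //; exact: openT.
- by rewrite addKr.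
- by split=> // u _; split=> //; rewrite opprD opprK -addrA addNr addr0.
- by move=> v; exact: (congr1 (fun g : V -> V => g a) (D1 0%N v)).
- move=> v w; apply: (etrans (congr1 (fun g : V -> V => 'D_v g a) (D1 0%N w))).
  exact: derive_cst.
Qed.

Lemma germ_sum (I : Type) (r : seq I) (B : I -> V -> V -> V) :
  (forall i, germ 0 0 id (B i)) ->
  germ 0 0 id (fun v w => \sum_(i <- r) B i v w).
Proof.
move=> GB; elim: r => [|i r IH].
  apply: germ_ext (germ_translation 0 0) => // v w; by rewrite big_nil.
apply: germ_ext (germ_comp IH (GB i)) => // v w; by rewrite big_cons.
Qed.

(** On the coordinate t = l(u) this map is the homography t / (1 - t l(w)), whence an
explicit inverse of the same form. When l(w) = 0 it is a usual shear. *)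
Definition shear (l : V -> R) (w u : V) : V :=
  u + (l u * (l u * (1 - l u * l w)^-1)) *: w.

Section Shear.
Variable l : {linear V -> R}.
Hypothesis cl : continuous l.

Let shear_dom (w : V) := [set u : V | 1 - l u * l w != 0].

Lemma shearK w u : shear_dom w u -> shear_dom (- w) (shear l w u) /\
  shear l (- w) (shear l w u) = u.
Proof.
rewrite /shear_dom /= => h.
have lN : l (- w) = - l w by exact: linearN.
have lE : l (shear l w u) = l u / (1 - l u * l w).
  have -> : l (shear l w u) = l u + (l u * (l u * (1 - l u * l w)^-1)) * l w.
    by rewrite [LHS]linearD; congr (_ + _); exact: linearZ.
  by field.
rewrite lE lN {1}/shear lE lN /shear.
set t := l u in h *; set c := l w in h *.
have h2 : 1 - t / (1 - t * c) * - c = (1 - t * c)^-1 by field.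
rewrite h2 invr_neq0 //; split=> //.
rewrite invrK -addrA scalerN -scalerBl.
have -> : t * (t / (1 - t * c)) - t / (1 - t * c) * (t / (1 - t * c) * (1 - t * c)) = 0.
  by field.
by rewrite scale0r addr0.
Qed.

Lemma open_shear_dom w : open (shear_dom w).
Proof.
have -> : shear_dom w = setT `&` (fun u => 1 - l u * l w) @^-1` [set x | x != 0].
  by rewrite setTI.
apply: open_setI_preimage; [exact: openT|exact: open_neq|] => u _.
apply: continuousB; first exact: cst_continuous.
by apply: continuousM; [exact: cl|exact: cst_continuous].
Qed.

Let q w u := l u * (l u * (1 - l u * l w)^-1).

Lemma Ck_linear_form k U : Ck k U l.
Proof.
have [C _] := @Ck_affine _ _ _ l l 0 (fun u => esym (addr0 _)) cl k.
exact: Ck_sub C.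
Qed.

Lemma Ck_shear_coef1 w k : Ck k (shear_dom w) (fun u => l u * (1 - l u * l w)^-1).
Proof.
apply: CkM; [exact: open_shear_dom|exact: Ck_linear_form|].
apply: CkV => //; first exact: open_shear_dom.
apply: CkD; [exact: open_shear_dom|exact: Ck_cst|].
apply: CkN; first exact: open_shear_dom.
by apply: CkM; [exact: open_shear_dom|exact: Ck_linear_form|exact: Ck_cst].
Qed.

Lemma Ck_shear_coef w k : Ck k (shear_dom w) (q w).
Proof. by apply: CkM; [exact: open_shear_dom|exact: Ck_linear_form|exact: Ck_shear_coef1]. Qed.

Lemma Ck_id k U : Ck k U (fun u : V => u).
Proof.
have [C _] := @Ck_affine _ _ _ (fun u : V => u) idfun 0 (fun u => esym (addr0 _))
  (fun u => cvg_id) k.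
exact: Ck_sub C.
Qed.

Lemma Ck_shear w k : Ck k (shear_dom w) (shear l w).
Proof.
apply: CkD; [exact: open_shear_dom|exact: Ck_id|].
apply/Ck_mxP => [|i j]; first exact: open_shear_dom.
rewrite (_ : (fun _ => _) = q w * cst (w i j)).
  by apply: CkM; [exact: open_shear_dom|exact: Ck_shear_coef|exact: Ck_cst].
by apply/funext => u; rewrite mxE.
Qed.

Lemma germ_shear w : germ 0 0 id (fun v v' => (2 * l v * l v') *: w).
Proof.
have l0 : l 0 = 0 by exact: linear0.
have d0 w' : shear_dom w' 0 by rewrite /shear_dom /= l0 mul0r subr0 oner_neq0.
have Dl v u : 'D_v l u = l v.
  have [_ Dl] := @Ck_affine _ _ _ l l 0 (fun u => esym (addr0 _)) cl 0.
  exact: (congr1 (fun g : V -> R => g u) (Dl v)).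
have Dq v : 'D_v (fun u => l u * (1 - l u * l w)^-1) 0 = l v.
  rewrite deriveM.
  - by rewrite l0 scale0r add0r Dl mul0r subr0 invr1 scale1r.
  - by apply/diff_derivable; exact: Ck_diff (Ck_linear_form 0 setT) _.
  - apply/diff_derivable; apply: differentiableV; last exact: d0.
    apply: differentiableB; first exact: differentiable_cst.
    apply: differentiableM; last exact: differentiable_cst.
    exact: Ck_diff (Ck_linear_form 0 setT) _.
have dq u : shear_dom w u -> differentiable (q w) u by exact: Ck_diff (Ck_shear_coef w 0).
have Ds v u : shear_dom w u -> 'D_v (shear l w) u = v + 'D_v (q w) u *: w.
  move=> du; rewrite deriveD; first by rewrite derive_id derive_scalel //; exact: dq.
    exact: derivable_id.
  by apply/diff_derivable; apply: differentiableZl; exact: dq.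
exists (shear l w), (shear l (- w)), (shear_dom w), (shear_dom (- w)); split.
- by split; [exact: open_shear_dom|exact: d0|exact: open_shear_dom|exact: d0].
- by rewrite /shear l0 mul0r scale0r addr0.
- split=> [k|k|u|u]; [exact: Ck_shear|exact: Ck_shear|exact: shearK|].
  by move=> /shearK; rewrite opprK.
- move=> v; rewrite Ds // deriveM.
  + by rewrite l0 !scale0r add0r mul0r scale0r scale0r addr0.
  + by apply/diff_derivable; exact: Ck_diff (Ck_linear_form 0 setT) _.
  + by apply/diff_derivable; exact: Ck_diff (Ck_shear_coef1 w 0) _.
- move=> v v'.
  rewrite (eq_on_derive (g := cst v' + (fun u => 'D_v' (q w) u *: w)) v (@open_shear_dom w)) //.
  have dDq : differentiable ('D_v' (q w)) 0.
    exact: Ck_diff (Ck_derive v' (Ck_shear_coef w 1)) _.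
  rewrite deriveD.
  + rewrite derive_cst add0r derive_scalel //.
    rewrite (derive2_mul0 _ _ (@open_shear_dom w) _ (Ck_linear_form 2 _)
      (Ck_shear_coef1 w 2)) //; last first.
      by rewrite l0 mul0r.
    by rewrite !Dl !Dq; congr (_ *: _); ring.
  + exact: derivable_cst.
  + by apply/diff_derivable; exact: differentiableZl.
  + by move=> u du; rewrite Ds.
Qed.

End Shear.

Definition linform (c : 'cV[R]_n) (u : V) : R := (u *m c) 0 0.

Lemma linform_is_linear c : linear (linform c).
Proof. by move=> k u v; rewrite /linform mulmxDl -scalemxAl !mxE. Qed.

HB.instance Definition _ c :=
  GRing.isLinear.Build R V R _ (linform c) (linform_is_linear c).

Lemma linform_continuous c : continuous (linform c).
Proof.
move=> u; apply: differentiable_continuous.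
apply: (@Ck_diff _ _ _ 0 setT) => //.
rewrite (_ : linform c = fun u => \sum_j (u 0 j * c j 0)).
  apply: Ck_sum => [|j _]; first exact: openT.
  apply: CkM; [exact: openT| |exact: Ck_cst].
  exact: ((Ck_mxP 0 (fun u : V => u) openT).1 (Ck_id 0 setT) 0 j).
by apply/funext => v; rewrite /linform mxE.
Qed.

Lemma linform_delta i u : linform (delta_mx i 0) u = u 0 i.
Proof.
rewrite /linform mxE (bigD1 i) //= big1 ?addr0 ?mxE ?eqxx ?mulr1 //.
by move=> j /negPf ji; rewrite mxE ji mulr0.
Qed.

(** Polarization: the products of two coordinates are combinations of squares of
linear forms, so that B is a sum of second derivatives of shears. *)
Lemma germ_symmetric_bilinear B :
  sym_bilinear B ->
  germ 0 0 id B.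
Proof.
move=> Bb; have [Bs _] := Bb.
pose e i : V := delta_mx 0 i.
pose l i : 'cV[R]_n := delta_mx i 0.
(* 1/4 = 1/2 (symmetrization in i, j) times 1/2 (a shear contributes 2 l l) *)
pose b i j := 4^-1 *: B (e i) (e j).
have G i j : germ 0 0 id (fun v w =>
    (2 * linform (l i + l j) v * linform (l i + l j) w) *: b i j +
    ((2 * linform (l i) v * linform (l i) w) *: - b i j +
    (2 * linform (l j) v * linform (l j) w) *: - b i j)).
  have S c w := germ_shear (@linform_continuous c) w.
  by have := germ_comp (germ_comp (S (l j) (- b i j)) (S (l i) (- b i j)))
    (S (l i + l j) (b i j)).
have := germ_sum (index_enum 'I_n) (fun i => germ_sum (index_enum 'I_n) (G i)).
apply: germ_ext => // v w.
have BE : B v w = \sum_i \sum_j (v 0 i * w 0 j) *: B (e i) (e j).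
  exact: sym_bilinear_sum.
have BE' : B v w = \sum_i \sum_j (v 0 j * w 0 i) *: B (e i) (e j).
  by rewrite BE exchange_big; apply: eq_bigr => i _; apply: eq_bigr => j _; rewrite Bs.
have -> : B v w = 2^-1 *: (B v w + B v w).
  by rewrite scalerDr -scalerDl (_ : 2^-1 + 2^-1 = 1 :> R) ?scale1r //; lra.
rewrite {1}BE BE' -big_split scaler_sumr; apply: eq_bigr => i _.
rewrite -big_split scaler_sumr; apply: eq_bigr => j _ /=.
rewrite /b !scalerN !scalerA -opprD -scalerDl -scalerBl scalerDr !scalerA -scalerDl.
have lD u : linform (l i + l j) u = u 0 i + u 0 j.
  by rewrite -!linform_delta /linform mulmxDr mxE.
rewrite !lD !linform_delta. congr (_ *: _); lra.
Qed.

Lemma germ_symmetry a B :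
  sym_bilinear B ->
  germ a a -%R B.
Proof.
move=> [Bs Bl].
have G : germ 0 0 id (fun v w => - B v w).
  apply: germ_symmetric_bilinear; split=> [v w|c u v w]; first by rewrite Bs.
  by rewrite Bl opprD scalerN.
have := germ_comp (germ_comp (germ_translation a 0) G)
  (germ_comp (germ_opp 0) (germ_translation 0 a)).
apply: germ_ext => [v|v w] /=; first by [].
by rewrite !add0r addr0 opprK.
Qed.

End Germs.

(** * Charts and tangent vectors *)
Section Charts.
Context {R : realType} {n : nat} {M : manifold R n}.
Local Notation V := 'rV[R]_n.
Implicit Types (x y z : M) (u v w : V).

Definition chart_img x : set V := chart_map x @` chart_dom x.

Definition transition x y : V -> V := chart_map y \o chart_inv x.

Definition overlap x y : set V :=
  chart_img x `&` [set u | chart_dom y (chart_inv x u)].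

Lemma open_chart_img x : open (chart_img x).
Proof. exact: chart_map_open (chart_open x) _. Qed.

Lemma chart_mapKd x y : chart_dom x y -> chart_inv x (chart_map x y) = y.
Proof. by move=> xy; rewrite chart_mapK // inE. Qed.

Lemma mem_chart_img x y : chart_dom x y -> chart_img x (chart_map x y).
Proof. by move=> xy; exists y. Qed.

Lemma chart_imgP x u : chart_img x u ->
  chart_dom x (chart_inv x u) /\ chart_map x (chart_inv x u) = u.
Proof. by move=> [y xy <-]; rewrite chart_mapKd. Qed.

Lemma chart_inv_continuous x u : chart_img x u -> {for u, continuous (chart_inv x)}.
Proof.
move=> xu; have [xi ui] := chart_imgP xu.
move=> N; rewrite nbhsE => -[N' [oN Ni] NN].
have oI : open (N' `&` chart_dom x) by apply: openI => //; exact: chart_open.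
have oImg := chart_map_open oI (@subIsetr _ _ _).
apply: (@filterS _ _ _ (chart_map x @` (N' `&` chart_dom x))).
  by move=> _ [y [Ny xy] <-] /=; rewrite chart_mapKd //; exact: NN.
apply: open_nbhs_nbhs; split=> //; exists (chart_inv x u) => //.
Qed.

Lemma open_overlap x y : open (overlap x y).
Proof.
apply: (@open_setI_preimage _ _ (chart_inv x) _ (chart_dom y)).
- exact: open_chart_img.
- exact: chart_open.
- by move=> u; exact: chart_inv_continuous.
Qed.

Lemma mem_overlap x y z : chart_dom x z -> chart_dom y z ->
  overlap x y (chart_map x z).
Proof. by move=> xz yz; split; [exact: mem_chart_img | rewrite /= chart_mapKd]. Qed.

Lemma overlapP x y u : overlap x y u ->
  exists z, [/\ chart_dom x z, chart_dom y z & u = chart_map x z].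
Proof.
move=> [/chart_imgP[xu ux] /= yu]; exists (chart_inv x u); split=> //.
Qed.

Lemma Ck_transition x y k : Ck k (overlap x y) (transition x y).
Proof.
move: k; apply/smooth_Ck => u /overlapP[z [xz yz ->]]; exact: chart_transition.
Qed.

Lemma transitionE x y z : chart_dom x z ->
  transition x y (chart_map x z) = chart_map y z.
Proof. by move=> xz; rewrite /transition /= chart_mapKd. Qed.

Lemma differentiable_transition x y z : chart_dom x z -> chart_dom y z ->
  differentiable (transition x y) (chart_map x z).
Proof.
move=> xz yz; exact: Ck_diff (Ck_transition x y 0) (mem_overlap xz yz).
Qed.

(** The tangent space at z is read in the chart preferred at z; this map sends a
vector written in the chart at x to it. Being a differential, it is linear for
all z, even outside the domain of the chart at x. *)
Definition frame x z : {linear V -> V} := 'd (transition x z) (chart_map x z).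

Lemma diff_transition_comp x y z v : chart_dom x z -> chart_dom y z ->
  forall m : M, chart_dom m z ->
  'd (transition x m) (chart_map x z) v =
  'd (transition y m) (chart_map y z) ('d (transition x y) (chart_map x z) v).
Proof.
move=> xz yz m wz.
have dxw := differentiable_transition xz wz.
have dxy := differentiable_transition xz yz.
have dyw := differentiable_transition yz wz.
have e : 'D_v (transition x m) (chart_map x z) =
    'D_v (transition y m \o transition x y) (chart_map x z).
  have oxy : open (overlap x y `&` overlap x m).
    by apply: openI; exact: open_overlap.
  apply: (eq_on_derive _ oxy); first by split; exact: mem_overlap.
  by move=> u [[xu yu] _]; rewrite /= /transition /= chart_mapKd.
have dyw' : differentiable (transition y m) (transition x y (chart_map x z)).
  by rewrite transitionE.
apply: (etrans (esym (deriveE v dxw))); apply: (etrans e).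
apply: (etrans (derive_comp v dxy dyw')).
apply: (etrans (deriveE _ dyw')); rewrite transitionE //.
exact: (congr1 ('d (transition y m) (chart_map y z)) (deriveE v dxy)).
Qed.

Lemma frame_comp x y z v : chart_dom x z -> chart_dom y z ->
  frame x z v = frame y z ('d (transition x y) (chart_map x z) v).
Proof. by move=> xz yz; apply: diff_transition_comp => //; exact: chart_mem. Qed.

Lemma diff_transition_id x z v : chart_dom x z ->
  'd (transition x x) (chart_map x z) v = v.
Proof.
move=> xz; have dx := differentiable_transition xz xz.
apply: (etrans (esym (deriveE v dx))).
have e := @eq_on_derive _ _ _ (transition x x) (id : V -> V) _ (chart_map x z) v
  (@open_chart_img x) (mem_chart_img xz) (fun u xu => (chart_imgP xu).2).
by apply: (etrans e); exact: derive_id.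
Qed.

Lemma frame_id x v : frame x x v = v.
Proof. by apply: diff_transition_id; exact: chart_mem. Qed.

Lemma frameK x z v : chart_dom x z ->
  'd (transition z x) (chart_map z z) (frame x z v) = v.
Proof.
move=> xz; rewrite -diff_transition_comp //; last exact: chart_mem.
exact: diff_transition_id.
Qed.

Lemma frameKV x z v : chart_dom x z ->
  frame x z ('d (transition z x) (chart_map z z) v) = v.
Proof.
by move=> xz; rewrite -frame_comp //; [exact: frame_id | exact: chart_mem].
Qed.

End Charts.

(** * Matrix-valued functions *)
Section MatrixCalculus.
Context {R : realType} {E : normedModType R}.

Lemma differentiable_mulmx m n p (f : E -> 'M[R]_(m, n)) (g : E -> 'M[R]_(n, p)) u :
  differentiable f u -> differentiable g u -> differentiable (fun z => f z *m g z) u.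
Proof.
move=> /differentiable_mxP df /differentiable_mxP dg; apply/differentiable_mxP => i j.
rewrite (_ : (fun z => _) = \sum_k (fun z => f z i k) * (fun z => g z k j)).
  by apply: differentiable_sum => k; exact: differentiableM.
by apply/funext => z; rewrite mxE fct_sumE.
Qed.

Lemma derive_mulmx m n p (f : E -> 'M[R]_(m, n)) (g : E -> 'M[R]_(n, p)) u v :
  differentiable f u -> differentiable g u ->
  'D_v (fun z => f z *m g z) u = 'D_v f u *m g u + f u *m 'D_v g u.
Proof.
move=> df dg; apply/matrixP => i j.
apply: (etrans (derive_coord v i j (differentiable_mulmx df dg))).
rewrite (_ : (fun z => _) = \sum_k (fun z => f z i k) * (fun z => g z k j)); last first.
  by apply/funext => z; rewrite mxE fct_sumE.
have df' k : derivable (fun z => f z i k) u v.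
  by apply/diff_derivable; exact: ((differentiable_mxP f u).1 df i k).
have dg' k : derivable (fun z => g z k j) u v.
  by apply/diff_derivable; exact: ((differentiable_mxP g u).1 dg k j).
rewrite derive_sum; last by move=> k; exact: derivableM.
rewrite !mxE -big_split; apply: eq_bigr => k _ /=.
have -> := derive_coord v i k df.
have -> := derive_coord v k j dg.
apply: (etrans (deriveM (df' k) (dg' k))).
by rewrite addrC; congr (_ + _); exact: mulrC.
Qed.

Lemma differentiable_trmx m n (f : E -> 'M[R]_(m, n)) u :
  differentiable f u -> differentiable (fun z => (f z)^T) u.
Proof.
move=> /differentiable_mxP df; apply/differentiable_mxP => i j.
by rewrite (_ : (fun z => _) = fun z => f z j i) //; apply/funext => z; rewrite mxE.
Qed.

Lemma derive_trmx m n (f : E -> 'M[R]_(m, n)) u v :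
  differentiable f u -> 'D_v (fun z => (f z)^T) u = ('D_v f u)^T.
Proof.
move=> df; apply/matrixP => i j.
apply: (etrans (derive_coord v i j (differentiable_trmx df))).
rewrite mxE; apply: (etrans _ (esym (derive_coord v j i df))).
by congr ('D_v _ u); apply/funext => z; rewrite mxE.
Qed.

End MatrixCalculus.

(** * The Koszul formula *)
Section Koszul.
Context {R : realType} {n : nat}.
Local Notation V := 'rV[R]_n.
Local Notation e i := (delta_mx 0 i : 'rV_n).
Implicit Types (u v w : V) (B : V -> V -> V) (H : 'M[R]_n) (D : 'I_n -> 'M[R]_n).

(** The matrix of the endomorphism B v, acting on row vectors. *)
Definition contract_mx B v : 'M[R]_n := \matrix_i B v (e i).

(** The linear form - (D_a H (i, .) + D_i H (a, .) - D_. H (a, i)), which is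
- 2 times a Christoffel symbol of the first kind. *)
Definition koszul_row D (a i : 'I_n) : V :=
  \row_k - (D a i k + D i a k - D k a i).

Definition koszul H D v w : V :=
  \sum_a \sum_i (v 0 a * w 0 i) *: (koszul_row D a i *m invmx H).

(** Here D a stands for the derivative of the metric in the direction of the a-th
coordinate; the condition says that - B / 2 is a metric connection. *)
Definition compatible H D B := forall v,
  (\sum_a v 0 a *: D a) *+ 2 = - (contract_mx B v *m H + H *m (contract_mx B v)^T).

Lemma contract_mxE B v w : sym_bilinear B -> B v w = w *m contract_mx B v.
Proof.
move=> [Bs Bl]; rewrite Bs {1}[w]row_sum_delta bilinear_suml // mulmx_sum_row.
apply: eq_bigr => i _; rewrite bilinear_scalel // Bs; congr (_ *: _).
by apply/rowP => k; rewrite !mxE.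
Qed.

Lemma koszul_sym H D : (forall a, (D a)^T = D a) -> sym_bilinear (koszul H D).
Proof.
move=> Ds; split.
  move=> v w; rewrite /koszul exchange_big; apply: eq_bigr => i _.
  apply: eq_bigr => a _; rewrite mulrC; congr (_ *: (_ *m _)).
  apply/rowP => k; rewrite !mxE (addrC (D a i k)); congr (- (_ - _)).
  by rewrite -[in LHS](Ds k) mxE.
move=> c u v w; rewrite /koszul scaler_sumr -big_split; apply: eq_bigr => a _.
rewrite scaler_sumr -big_split; apply: eq_bigr => i _.
by rewrite !mxE mulrDl scalerDl -!mulrA !scalerA.
Qed.

Lemma sum_basis_scale (F : lmodType R) (D : 'I_n -> F) a :
  \sum_b (e a) 0 b *: D b = D a.
Proof.
rewrite (bigD1 a) //= big1 => [|b /negPf ba]; rewrite mxE !eqxx ?ba /=.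
  by rewrite addr0 scale1r.
by rewrite scale0r.
Qed.

(** In the combination D_a H (i, k) + D_i H (a, k) - D_k H (a, i), the symmetry of B
cancels all terms but two copies of H (B (a, i), k). *)
Lemma koszul_unique H D B : H \in unitmx -> H^T = H -> sym_bilinear B ->
  (forall a, (D a)^T = D a) ->
  compatible H D B -> forall v w, B v w = koszul H D v w.
Proof.
move=> Hu Hs Bb Ds Bc v w.
rewrite (sym_bilinear_sum v w Bb); apply: eq_bigr => a _; apply: eq_bigr => i _.
congr (_ *: _); apply: (canRL (mulmxK Hu)).
pose beta a i k := (B (e a) (e i) *m H) 0 k.
have betaE b j k : (contract_mx B (e b) *m H) j k = beta b j k.
  by rewrite /beta !mxE; apply: eq_bigr => l _; rewrite mxE.
have betaC b j k : beta b j k = beta j b k by rewrite /beta Bb.1.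
have cE b j k : D b j k *+ 2 = - (beta b j k + beta b k j).
  have := congr1 (fun A : 'M[R]_n => A j k) (Bc (e b)).
  rewrite sum_basis_scale -{2}Hs -trmx_mul.
  have -> : (D b *+ 2) j k = D b j k *+ 2 by rewrite !mulr2n mxE.
  by move=> ->; rewrite mxE mxE [_^T _ _]mxE !betaE.
have DC b j k : D b j k = D b k j by rewrite -[in LHS](Ds b) mxE.
apply/rowP => k; rewrite -/(beta a i k) mxE.
have := cE a i k; have := cE i a k; have := cE k a i.
rewrite (betaC i a k) (betaC k a i) (betaC k i a) (betaC i k a) !mulr2n; lra.
Qed.

Lemma koszul_compatible H D : H \in unitmx -> H^T = H -> (forall a, (D a)^T = D a) ->
  compatible H D (koszul H D).
Proof.
move=> Hu Hs Ds v.
have cE i k : (contract_mx (koszul H D) v *m H) i k = \sum_a v 0 a * koszul_row D a i 0 k.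
  have -> : (contract_mx (koszul H D) v *m H) i k = (koszul H D v (e i) *m H) 0 k.
    by rewrite !mxE; apply: eq_bigr => l _; rewrite mxE.
  have -> : koszul H D v (e i) = \sum_a v 0 a *: (koszul_row D a i *m invmx H).
    apply: eq_bigr => a _; rewrite (bigD1 i) //= big1 => [|j /negPf ji].
      by rewrite addr0 mxE !eqxx mulr1.
    by rewrite mxE ji andbF mulr0 scale0r.
  rewrite mulmx_suml summxE; apply: eq_bigr => a _.
  by rewrite -scalemxAl mulmxKV // mxE.
apply/matrixP => i k.
have -> : H *m (contract_mx (koszul H D) v)^T = (contract_mx (koszul H D) v *m H)^T.
  by rewrite trmx_mul Hs.
rewrite mulr2n mxE summxE [RHS]mxE [X in - X]mxE [_^T _ _]mxE !cE.
rewrite -!big_split -sumrN.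
apply: eq_bigr => a _; rewrite !mxE.
have DC b j l : D b j l = D b l j by rewrite -[in LHS](Ds b) mxE.
by rewrite (DC a k i) /=; ring.
Qed.

End Koszul.

(** * Symmetric matrices and their components *)
Section SymmetricComponents.
Context {R : realType} {n : nat}.

Definition comp_row (A : 'M[R]_n) : 'rV[R]_#|{: sym_idx n}| :=
  \row_k A (val (enum_val k)).1 (val (enum_val k)).2.

Lemma sym_idx_subproof (i j : 'I_n) :
  ((if (i <= j)%N then (i, j) else (j, i)).1 <=
   (if (i <= j)%N then (i, j) else (j, i)).2)%N.
Proof. by case: (leqP i j) => [|/ltnW] /=. Qed.

Definition to_sym_idx (i j : 'I_n) : sym_idx n :=
  exist _ (if (i <= j)%N then (i, j) else (j, i)) (sym_idx_subproof i j).

Definition sym_mx (r : 'rV[R]_#|{: sym_idx n}|) : 'M[R]_n :=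
  \matrix_(i, j) r 0 (enum_rank (to_sym_idx i j)).

Lemma to_sym_idxC i j : to_sym_idx i j = to_sym_idx j i.
Proof. by apply/val_inj => /=; case: ltngtP => // /val_inj ->. Qed.

Lemma sym_mx_sym r : (sym_mx r)^T = sym_mx r.
Proof. by apply/matrixP => i j; rewrite !mxE to_sym_idxC. Qed.

Lemma sym_mxK : cancel sym_mx comp_row.
Proof.
move=> r; apply/rowP => k; rewrite !mxE.
rewrite -[in RHS](enum_valK k); congr (r 0 (enum_rank _)).
by apply/val_inj => /=; case: (enum_val k) => -[i j] /= ->.
Qed.

Lemma comp_rowK A : A^T = A -> sym_mx (comp_row A) = A.
Proof.
move=> As; apply/matrixP => i j; rewrite !mxE enum_rankK /=.
by case: ifP => //= _; rewrite -[in RHS]As mxE.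
Qed.

Lemma comp_row_linear : linear comp_row.
Proof. by move=> c A B; apply/rowP => k; rewrite !mxE. Qed.

HB.instance Definition _ := GRing.isLinear.Build R _ _ _ comp_row comp_row_linear.

Lemma sym_mx_linear : linear sym_mx.
Proof. by move=> c A B; apply/matrixP => i j; rewrite !mxE. Qed.

HB.instance Definition _ := GRing.isLinear.Build R _ _ _ sym_mx sym_mx_linear.

Lemma Ck_sym_mx (E : normedModType R) (f : E -> 'rV[R]_#|{: sym_idx n}|) U k :
  open U -> Ck k U f -> Ck k U (sym_mx \o f).
Proof.
move=> oU /(Ck_mxP _ _ oU) Cf; apply/Ck_mxP => // i j.
have := Cf 0 (enum_rank (to_sym_idx i j)).
by congr (Ck _ _ _); apply/funext => u; rewrite /= mxE.
Qed.

Lemma derive_sym_mx (E : normedModType R) (f : E -> 'rV[R]_#|{: sym_idx n}|) u v :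
  differentiable f u ->
  differentiable (sym_mx \o f) u /\ 'D_v (sym_mx \o f) u = sym_mx ('D_v f u).
Proof.
move=> df.
have E1 i j : (fun z => (sym_mx \o f) z i j) =
    (fun z => f z 0 (enum_rank (to_sym_idx i j))).
  by apply/funext => z; rewrite /= mxE.
have ds : differentiable (sym_mx \o f) u.
  apply/differentiable_mxP => i j; rewrite E1.
  exact: ((differentiable_mxP f u).1 df _ _).
split=> //; apply/matrixP => i j; apply: (etrans (derive_coord v i j ds)).
rewrite [RHS]mxE; apply: (etrans _ (esym (derive_coord v 0 _ df))).
exact: (congr1 (fun g : E -> R => 'D_v g u) (E1 i j)).
Qed.

Lemma derive_comp_row (E : normedModType R) (f : E -> 'M[R]_n) u v :
  differentiable f u ->
  differentiable (comp_row \o f) u /\ 'D_v (comp_row \o f) u = comp_row ('D_v f u).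
Proof.
move=> df.
have E1 i j : (fun z => (comp_row \o f) z i j) =
    (fun z => f z (val (enum_val j)).1 (val (enum_val j)).2).
  by apply/funext => z; rewrite /= mxE.
have ds : differentiable (comp_row \o f) u.
  apply/differentiable_mxP => i j; rewrite E1.
  exact: ((differentiable_mxP f u).1 df _ _).
split=> //; apply/matrixP => i j; apply: (etrans (derive_coord v i j ds)).
rewrite [RHS]mxE; apply: (etrans _ (esym (derive_coord v _ _ df))).
exact: (congr1 (fun g : E -> R => 'D_v g u) (E1 i j)).
Qed.

End SymmetricComponents.

(** * Transport of tensors by a symmetry *)
Section Forms.
Context {R : realType}.

Lemma sym2_ext (W : lmodType R) (g g' : sym2 W) :
  (forall X Y, g X Y = g' X Y) -> g = g'.
Proof.
case: g g' => [g gl gs] [g' gl' gs'] /= gg'.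
have e : g = g' by apply/funext => X; apply/funext => Y.
by case: _ / e gl' gs' {gg'} => gl' gs'; congr Sym2; exact: Prop_irrelevance.
Qed.

Lemma sym2_scalel (W : lmodType R) (g : sym2 W) a X Z : g (a *: X) Z = a * g X Z.
Proof.
have g0 : g 0 Z = 0.
  by have := sym2_linear g (-1) 0 0 Z; rewrite scaler0 addr0 mulN1r addNr.
by have := sym2_linear g a X 0 Z; rewrite g0 !addr0.
Qed.

Lemma sym2_suml (W : lmodType R) (g : sym2 W) (I : Type) (r : seq I)
    (F : I -> W) Z : g (\sum_(i <- r) F i) Z = \sum_(i <- r) g (F i) Z.
Proof.
elim/big_rec2 : _ => [|i x y _ <-].
  by have := sym2_scalel g 0 0 Z; rewrite scale0r mul0r.
by have := sym2_linear g 1 (F i) y Z; rewrite scale1r mul1r.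
Qed.

Lemma sym2_mx n (W : lmodType R) (g : sym2 W) (L : {linear 'rV[R]_n -> W}) v w :
  g (L v) (L w) =
  (v *m (\matrix_(i, j) g (L (delta_mx 0 i)) (L (delta_mx 0 j))) *m w^T) 0 0.
Proof.
rewrite {1}[v]row_sum_delta linear_sum sym2_suml -mulmxA mxE.
apply: eq_bigr => i _; rewrite linearZ sym2_scalel; congr (_ * _).
rewrite sym2_sym {1}[w]row_sum_delta linear_sum sym2_suml mxE.
apply: eq_bigr => j _; rewrite linearZ sym2_scalel !mxE mulrC.
by rewrite sym2_sym.
Qed.

End Forms.

Section Push.
Context {R : realType} {n : nat} {M : manifold R n}.
Local Notation V := 'rV[R]_n.
Local Notation e i := (delta_mx 0 i : 'rV_n).
Implicit Types (x y z : M) (u v w : V) (p : S2 M) (s : M -> M).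

Definition gram x p : 'M[R]_n :=
  \matrix_(i, j) projT2 p (frame x (projT1 p) (e i)) (frame x (projT1 p) (e j)).

Lemma S2_componentsE x p : S2_components x p = comp_row (gram x p).
Proof. by apply/rowP => k; rewrite !mxE. Qed.

Lemma gram_sym x p : (gram x p)^T = gram x p.
Proof. by apply/matrixP => i j; rewrite !mxE sym2_sym. Qed.

Lemma gramE x p : gram x p = sym_mx (S2_components x p).
Proof. by rewrite S2_componentsE comp_rowK // gram_sym. Qed.

(** For s x = x this is the local representative of s at x; unlike the latter it
makes sense for a symmetry at a point other than x. *)
Definition rep x s : V -> V := chart_map x \o s \o chart_inv x.

Lemma jacobianP f u v : differentiable f u -> 'D_v f u = v *m jacobian f u :> V.
Proof. exact: deriveEjacobian. Qed.

Lemma Ck_jacobian k (U : set V) (f : V -> V) : open U -> Ck k.+1 U f ->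
  Ck k U (jacobian f).
Proof.
move=> oU Cf; apply/Ck_mxP => // i j.
have Ci := (Ck_mxP k ('D_(e i) f : V -> V) oU).1 (Ck_derive (e i) Cf) 0 j.
refine (Ck_eq oU _ Ci) => u Uu.
have df := Ck_diff Cf Uu.
have -> := jacobianP (e i) df.
by rewrite -rowE mxE.
Qed.

(** The domain on which the transport of tensors by s can be computed in the single
chart at x. *)
Record adapted x s (O : set V) : Prop := Adapted {
  adapted_open : open O;
  adapted_img : O `<=` chart_img x;
  adapted_dom : forall u, O u -> chart_dom x (s (chart_inv x u));
  adapted_Ck : forall k, Ck k O (rep x s);
  adapted_unit : forall u, O u -> jacobian (rep x s) u \in unitmx }.

(** The differential - id is invertible, and the determinant is continuous. *)
Lemma exists_adapted x s : smooth_at mcharts s x -> s x = x ->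
  (forall v, 'D_v (rep x s) (chart_map x x) = - v) ->
  exists2 O, adapted x s O & O (chart_map x x).
Proof.
move=> [/= sd]; rewrite /local_rep /= => ss sx Ds.
move: sd ss; rewrite sx => sd /smooth_nearP[U [oU Ux CU]].
move: sd => /nbhs_interior; rewrite nbhsE => -[N [oN Nx] NI].
have Nd y : N y -> chart_dom x (s y) by move=> /NI /interior_subset.
pose U1 := (U `&` chart_img x) `&` chart_inv x @^-1` N.
have oU1 : open U1.
  apply: open_setI_preimage => //.
    by apply: openI => //; exact: open_chart_img.
  by move=> u [_]; exact: chart_inv_continuous.
have xx := chart_mem x.
have U1x : U1 (chart_map x x).
  by split; [split=> //; exact: mem_chart_img | rewrite /= chart_mapKd].
have CU1 k : Ck k U1 (rep x s) by apply: Ck_sub (CU k) => u [[]].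
pose dt (u : V) : R := \det (jacobian (rep x s) u).
have Cdet : Ck 0 U1 dt.
  by apply: Ck_det => //; exact: Ck_jacobian.
have oU2 : open (U1 `&` dt @^-1` [set t : R | t != 0]).
  apply: open_setI_preimage => //.
  by move=> u /(Ck_diff Cdet)/differentiable_continuous.
exists (U1 `&` dt @^-1` [set t : R | t != 0]).
  split=> //.
  - by move=> u [[[_]]].
  - by move=> u [[_ Nu] _]; exact: Nd.
  - by move=> k; apply: Ck_sub (CU1 k) => u [].
  - by move=> u [_ /=]; rewrite unitmxE unitfE.
split=> //=; rewrite /dt.
have -> : jacobian (rep x s) (chart_map x x) = - 1%:M.
  apply/row_matrixP => i; rewrite !rowE mulmxN mulmx1 -jacobianP ?Ds //.
  exact: Ck_diff (CU1 0%N) U1x.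
rewrite -unitfE -unitmxE; apply: (mulmx1_unit (B := - 1%:M) _).1.
by rewrite mulmxN mulNmx mulmx1 opprK.
Qed.

(** The differential of s at z is defined through the preferred charts at z and s z,
which vary with z without any regularity. The chain rule shows that in the
frames of the chart at x it is the differential of one fixed map. *)
Lemma mdiff_frame x s O z v : adapted x s O -> chart_dom x z -> O (chart_map x z) ->
  mdiff mcharts s z (frame x z v) = frame x (s z) ('D_v (rep x s) (chart_map x z)).
Proof.
move=> [oO OI Od CO _] xz Oz; have zz := chart_mem z.
have xsz : chart_dom x (s z) by have := Od _ Oz; rewrite chart_mapKd.
have dT := differentiable_transition zz xz.
have dr : differentiable (rep x s) (transition z x (chart_map z z)).
  by rewrite (transitionE x zz); exact: Ck_diff (CO 0%N) Oz.
have repz : rep x s (transition z x (chart_map z z)) = chart_map x (s z).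
  by rewrite transitionE // /rep /= chart_mapKd.
have dT' : differentiable (transition x (s z)) (rep x s (transition z x (chart_map z z))).
  by rewrite repz; apply: differentiable_transition => //; exact: chart_mem.
have dc := differentiable_comp dT dr.
have [_ E] : differentiable (local_rep mcharts s z) (chart_map z z) /\
   'd (local_rep mcharts s z) (chart_map z z) =
   'd (transition x (s z) \o (rep x s \o transition z x)) (chart_map z z) :> (V -> V).
  apply: near_eq_diff; last exact: differentiable_comp.
  have oN : open (overlap z x `&` transition z x @^-1` O).
    apply: open_setI_preimage; [exact: open_overlap|exact: oO|].
    by move=> u zu; apply: continuous_Ck zu => k; exact: Ck_transition.
  have Nz : (overlap z x `&` transition z x @^-1` O) (chart_map z z).
    by split; [exact: mem_overlap | rewrite /= transitionE].
  apply: (@filterS _ _ _ (overlap z x `&` transition z x @^-1` O)).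
    move=> u [/overlapP[z' [zz' xz' ->]]] /=.
    rewrite transitionE // => Oz'; rewrite /local_rep /rep /= /transition /=.
    have xsz' : chart_dom x (s z') by have := Od _ Oz'; rewrite chart_mapKd.
    by rewrite (chart_mapKd zz') (chart_mapKd xz') (chart_mapKd xsz').
  exact: open_nbhs_nbhs.
rewrite /mdiff; apply: (etrans (congr1 (fun f : V -> V => f (frame x z v)) E)).
apply: (etrans (congr1 (fun f : V -> V => f (frame x z v)) (diff_comp dc dT'))).
rewrite /= repz; congr (frame x (s z) _).
apply: (etrans (congr1 (fun f : V -> V => f (frame x z v)) (diff_comp dT dr))).
have dr' : differentiable (rep x s) (chart_map x z) by exact: Ck_diff (CO 0%N) Oz.
apply: (etrans _ (esym (deriveE v dr'))); rewrite /= (transitionE x zz).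
exact: (congr1 ('d (rep x s) (chart_map x z)) (frameK v xz)).
Qed.

Lemma lfun_inv_frame (V1 V2 : vectType R) (f : 'Hom(V1, V2)) (J : 'M[R]_n)
    (F : V -> V1) (F' : V1 -> V) (G : V -> V2) (G' : V2 -> V) :
  cancel F' F -> cancel G G' -> J \in unitmx ->
  (forall v, f (F v) = G (v *m J)) ->
  forall v, (f^-1)%VF (G v) = F (v *m invmx J).
Proof.
move=> F'K GK Ju fE.
have f_inj : lker f == 0%VS.
  apply/lker0P => X Y; rewrite -(F'K X) -(F'K Y) !fE.
  by move=> /(can_inj GK) /(can_inj (mulmxK Ju)) ->.
by move=> v; rewrite -{1}(mulmxKV Ju v) -fE lker0_lfunK.
Qed.

Lemma form_delta (A : 'M[R]_n) i j : (e i *m A *m (e j)^T) 0 0 = A i j.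
Proof. by rewrite -rowE trmx_delta -colE !mxE. Qed.

Lemma gram_push x s O p : adapted x s O -> chart_dom x (projT1 p) ->
  O (chart_map x (projT1 p)) ->
  let K := invmx (jacobian (rep x s) (chart_map x (projT1 p))) in
  gram x (push s p) = K *m gram x p *m K^T.
Proof.
move=> A; case: p => z g /= xz Oz.
have xsz : chart_dom x (s z) by have := adapted_dom A Oz; rewrite chart_mapKd.
set J := jacobian _ _.
have Ju : J \in unitmx by exact: adapted_unit A _ Oz.
pose ds : 'Hom(TM z, TM (s z)) := linfun (mdiff mcharts s z).
have dsE v : ds (frame x z v) = frame x (s z) (v *m J).
  apply: (etrans (lfunE _ _)); apply: (etrans (mdiff_frame v A xz Oz)).
  congr (frame x (s z) _).
  by apply: jacobianP; exact: Ck_diff (adapted_Ck A 0) Oz.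
have dsK := lfun_inv_frame (fun X => frameKV X xz) (fun v => frameK v xsz) Ju dsE.
apply/matrixP => i j; rewrite mxE /= -/ds.
rewrite !dsK (sym2_mx g (frame x z)).
by rewrite -[RHS]form_delta trmx_mul !mulmxA.
Qed.

Lemma derive_jacobian (U : set V) (f : V -> V) a v : open U -> U a -> Ck 2 U f ->
  'D_v (jacobian f) a = \matrix_i 'D_v ('D_(e i) f) a.
Proof.
move=> oU Ua Cf; apply/row_matrixP => i; rewrite rowK rowE.
have dJ : differentiable (jacobian f) a by exact: Ck_diff (Ck_jacobian oU Cf) _.
have E1 : 'D_v (fun u => (cst (e i) u : V) *m jacobian f u) a = 'D_v ('D_(e i) f) a.
  apply: (eq_on_derive _ oU Ua) => u Uu.
  by rewrite -jacobianP //; exact: Ck_diff Cf _.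
apply: (etrans _ E1); apply: esym.
apply: (etrans (derive_mulmx v (differentiable_cst (e i) a) dJ)).
by rewrite derive_cst mul0mx add0r.
Qed.

End Push.

Section PushVelocity.
Context {R : realType} {n : nat} {M : manifold R n}.
Local Notation V := 'rV[R]_n.
Variables (x : M) (s : M -> M) (B : V -> V -> V) (O : set V).
Hypothesis sx : s x = x.
Hypothesis sO : adapted x s O.
Hypothesis Ox : O (chart_map x x).
Hypothesis Ds : forall v, 'D_v (rep x s) (chart_map x x) = - v.
Hypothesis DDs : forall v w, 'D_v ('D_w (rep x s)) (chart_map x x) = B v w.

Let J := jacobian (rep x s).

Lemma jacobian_center : J (chart_map x x) = - 1%:M.
Proof.
apply/row_matrixP => i; rewrite !rowE mulmxN mulmx1.
rewrite -(jacobianP _ (Ck_diff (adapted_Ck sO 0) Ox)); exact: Ds.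
Qed.

Lemma sandwich_derivative (C A A' : 'M[R]_n) :
  (- C *m A + - 1%:M *m A') *m (- 1%:M)^T + (- 1%:M *m A) *m (- C)^T =
  A' + (C *m A + A *m C^T).
Proof.
have tN (D : 'M[R]_n) : (- D)^T = - D^T by apply/matrixP => i j; rewrite !mxE.
rewrite !tN trmx1 !(mulNmx, mulmxN, mulmx1, mul1mx, opprK, opprD).
by rewrite addrA [A' + _]addrC.
Qed.

(** With K the inverse of the Jacobian along the path, K is - 1 at time 0, and
differentiating K J = 1 gives K' = - J' = - C. *)
Lemma velocity_gram (u : R -> V) (A : R -> 'M[R]_n) :
  differentiable u 0 -> differentiable A 0 -> u 0 = chart_map x x ->
  let P t := invmx (J (u t)) *m A t *m (invmx (J (u t)))^T in
  let C := contract_mx B ('D_1 u 0) in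
  differentiable P 0 /\ 'D_1 P 0 = 'D_1 A 0 + (C *m A 0 + A 0 *m C^T).
Proof.
move=> du dA u0 P C.
have oO := adapted_open sO.
have CJ k : Ck k O J by exact: Ck_jacobian (adapted_Ck sO _).
have CK : Ck 0 O (fun v => invmx (J v)).
  by apply: Ck_invmx => //; exact: adapted_unit sO.
have dJ : differentiable J (u 0) by rewrite u0; exact: Ck_diff (CJ 0%N) Ox.
have dK : differentiable (fun v => invmx (J v)) (u 0).
  by rewrite u0; exact: Ck_diff CK Ox.
have dJu : differentiable (J \o u) 0 by exact: differentiable_comp.
pose K : R -> 'M[R]_n := (fun v => invmx (J v)) \o u.
have dKu : differentiable K 0 by exact: differentiable_comp.
have J0 : J (u 0) = - 1%:M by rewrite u0 jacobian_center.
have K0 : K 0 = - 1%:M.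
  have Ju : J (u 0) \in unitmx by rewrite u0; exact: adapted_unit sO _ Ox.
  have := mulmxV Ju; rewrite {1}J0 mulNmx mul1mx => <-.
  by rewrite opprK.
have J' : 'D_1 (J \o u) 0 = C.
  apply: (etrans (derive_comp (1 : R^o) du dJ)); rewrite u0.
  apply: (etrans (derive_jacobian _ oO Ox (adapted_Ck sO 2))).
  by apply/row_matrixP => i; rewrite !rowK DDs.
have K' : 'D_1 K 0 = - C.
  have e1 : 'D_1 (fun t => K t *m (J \o u) t) 0 = 0.
    apply: (etrans _ (derive_cst (1%:M : 'M[R]_n) (0 : R) 1)).
    apply: near_eq_derive.
    have Ou : \forall t \near 0, O (u t).
      apply: (differentiable_continuous du).
      by apply: open_nbhs_nbhs; split=> //; rewrite u0.
    apply: filterS Ou => t Ot; rewrite /K /= mulVmx //.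
    exact: adapted_unit sO _ Ot.
  have := derive_mulmx (1 : R^o) dKu dJu; rewrite e1 J' K0 /= J0 mulmxN mulmx1 mulNmx mul1mx.
  by move=> /esym/eqP; rewrite subr_eq0 => /eqP <-; rewrite opprK.
have dKA : differentiable (fun t => K t *m A t) 0 by exact: differentiable_mulmx.
have dKT : differentiable (fun t => (K t)^T) 0 by exact: differentiable_trmx.
split; first exact: differentiable_mulmx.
apply: (etrans (derive_mulmx (1 : R^o) dKA dKT)).
have -> := derive_trmx (1 : R^o) dKu.
have -> := derive_mulmx (1 : R^o) dKu dA.
rewrite K' K0; exact: sandwich_derivative.
Qed.

End PushVelocity.

Section Velocity.
Context {R : realType} {n : nat} {M : manifold R n}.
Local Notation V := 'rV[R]_n.
Local Notation N := #|{: sym_idx n}|.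
Local Notation TS := (V * 'rV[R]_N)%type.
Variables (x : M) (g : sym2 (TM x)).
Let p := S2_point g.

Lemma derive1_pair (a : R -> V) (b : R -> 'rV[R]_N) :
  differentiable a 0 -> differentiable b 0 ->
  derive1 (fun t => (a t, b t) : TS) 0 = ('D_1 a 0, 'D_1 b 0).
Proof.
move=> da db; rewrite derive1E' ?diff_pair //; last exact: differentiable_pair.
by rewrite !deriveE.
Qed.

Lemma smooth_path_components (c : R -> S2 M) : smooth_path S2_charts c -> c 0 = p ->
  [/\ \forall t \near 0, chart_dom x (projT1 (c t)),
      differentiable (fun t => chart_map x (projT1 (c t))) (0 : R),
      differentiable (fun t => S2_components x (c t)) (0 : R) &
      velocity S2_charts c =
        ('D_1 (fun t => chart_map x (projT1 (c t))) 0,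
         'D_1 (fun t => S2_components x (c t)) 0) :> TS].
Proof.
move=> [cd cs] c0; rewrite /velocity c0; rewrite c0 in cd cs.
have df := nbhs_singleton cs [::].
have da : differentiable (fun t => chart_map x (projT1 (c t))) (0 : R).
  apply: (@differentiable_comp _ _ _ _ _ (fst : TS -> V) _ df).
  by apply: linear_differentiable => q; exact: cvg_fst.
have db : differentiable (fun t => S2_components x (c t)) (0 : R).
  apply: (@differentiable_comp _ _ _ _ _ (snd : TS -> 'rV[R]_N) _ df).
  by apply: linear_differentiable => q; exact: cvg_snd.
by split=> //; exact: derive1_pair da db.
Qed.

(** The transported path has components K A K^T, where A is the symmetric matrix of
components of the given path. *)
Lemma push_velocity (s : M -> M) (B : V -> V -> V) (O : set V) :
  s x = x -> adapted x s O -> O (chart_map x x) ->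
  (forall v, 'D_v (rep x s) (chart_map x x) = - v) ->
  (forall v w, 'D_v ('D_w (rep x s)) (chart_map x x) = B v w) ->
  forall (c : R -> S2 M) (X : TS),
  smooth_path S2_charts c -> c 0 = p -> velocity S2_charts c = X ->
  velocity S2_charts (push s \o c) =
  (- X.1, X.2 + comp_row (contract_mx B X.1 *m gram x p +
                          gram x p *m (contract_mx B X.1)^T)) :> TS.
Proof.
move=> sx sO Ox Ds DDs c X cs c0.
have [cd da db ->] := smooth_path_components cs c0 => <- /=.
set a := fun t => chart_map x (projT1 (c t)).
set b := fun t => S2_components x (c t).
have a0 : a 0 = chart_map x x by rewrite /a c0.
have [dA A'] := derive_sym_mx (1 : R^o) db.
have A0 : (sym_mx \o b) 0 = gram x p by rewrite /b /= c0 -gramE.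
have [dP P'] := velocity_gram sO Ox Ds DDs da dA a0.
set P := (fun t => _) in dP P'.
have [dQ Q'] := derive_comp_row (1 : R^o) dP.
have dr : differentiable (rep x s) (a 0).
  by rewrite a0; exact: Ck_diff (adapted_Ck sO 0) Ox.
have Oa : \forall t \near 0, O (a t).
  apply: (differentiable_continuous da).
  apply: open_nbhs_nbhs; split; first exact: adapted_open sO.
  by rewrite -[X in O X]/(a 0) a0.
have pushE : \forall t \near 0,
    ((rep x s \o a) t, (comp_row \o P) t) =
    (Defs.coord S2_charts ((push s \o c) 0) \o (push s \o c)) t.
  move: cd Oa; apply: filterS2 => t xt Ot.
  rewrite /= c0 /= sx; congr pair; first by rewrite /rep /= chart_mapKd.
  by rewrite S2_componentsE (gram_push sO) // (gramE x (c t)).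
rewrite /velocity derive1E.
apply: (etrans (esym (near_eq_derive _ pushE))).
rewrite -derive1E.
have dra : differentiable (rep x s \o a) 0 by exact: differentiable_comp.
apply: (etrans (derive1_pair dra dQ)).
congr pair.
  apply: (etrans (derive_comp (1 : R^o) da dr)).
  by rewrite -[LHS]/('D_('D_1 a 0) (rep x s) (a 0)) a0 Ds.
apply: (etrans Q'); rewrite P' A0 linearD /=; congr (_ + _).
by rewrite A' sym_mxK.
Qed.

End Velocity.

(** * The map Psi *)
Section LinearPath.
Context {R : realType} {E : normedModType R} (X : E).

Definition scalar_line (t : R^o) : E := t *: X.

Lemma scalar_line_is_linear : linear scalar_line.
Proof. by move=> a t t'; rewrite /scalar_line scalerDl scalerA. Qed.

HB.instance Definition _ := GRing.isLinear.Build R R^o E _ scalar_line scalar_line_is_linear.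

Lemma scalar_line_continuous : continuous scalar_line.
Proof. exact: scalel_continuous. Qed.

End LinearPath.

Section PsiFormula.
Context {R : realType} {n : nat} {M : manifold R n}.
Local Notation V := 'rV[R]_n.
Local Notation N := #|{: sym_idx n}|.
Local Notation TS := (V * 'rV[R]_N)%type.
Implicit Types (r : 'rV[R]_N) (z : M).

Lemma form_section (W : Type) (L : W -> V) (F : V -> W) (A : 'M[R]_n) :
  cancel F L -> forall i j,
  (L (F (delta_mx 0 i)) *m A *m (L (F (delta_mx 0 j)))^T) 0 0 = A i j.
Proof. by move=> FK i j; rewrite !FK form_delta. Qed.

Section ChartTensor.
Variables (x z : M) (r : 'rV[R]_N).

Let L : {linear V -> V} := 'd (transition z x) (chart_map z z).
(** The tensor at z with components r in the chart at x. For z outside of this chart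
L is still linear, so that the formula defines a tensor in all cases. *)
Definition chart_tensor_fun (X Y : TM z) : R := (L X *m sym_mx r *m (L Y)^T) 0 0.

Lemma chart_tensor_linear a X Y Z :
  chart_tensor_fun (a *: X + Y) Z = a * chart_tensor_fun X Z + chart_tensor_fun Y Z.
Proof. by rewrite /chart_tensor_fun linearP !mulmxDl -!scalemxAl !mxE. Qed.

Lemma chart_tensor_sym X Y : chart_tensor_fun X Y = chart_tensor_fun Y X.
Proof.
rewrite /chart_tensor_fun.
transitivity ((L X *m sym_mx r *m (L Y)^T)^T 0 0); first by rewrite [RHS]mxE.
by rewrite !trmx_mul trmxK sym_mx_sym mulmxA.
Qed.

Definition chart_tensor : sym2 (TM z) := Sym2 chart_tensor_linear chart_tensor_sym.

Lemma gram_chart_tensor : chart_dom x z -> gram x (S2_point chart_tensor) = sym_mx r.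
Proof.
move=> xz; apply/matrixP => i j; rewrite mxE /= /chart_tensor_fun.
have Lf v : L (frame x z v) = v by exact: frameK.
exact: (@form_section _ L (frame x z) (sym_mx r) Lf i j).
Qed.

End ChartTensor.

Lemma chart_tensor_center x z (g : sym2 (TM x)) r :
  z = x -> r = S2_components x (S2_point g) -> S2_point (chart_tensor x z r) = S2_point g.
Proof.
move=> -> ->; congr S2_point; apply: sym2_ext => X Y.
rewrite /= /chart_tensor_fun -gramE.
have Lf v : 'd (transition x x) (chart_map x x) v = v := frame_id x v.
rewrite !Lf -{2}(frame_id x X) -{2}(frame_id x Y).
by rewrite (sym2_mx g (frame x x)).
Qed.

Variables (x : M) (g : sym2 (TM x)).
Let p := S2_point g.

(** The path that is affine in the coordinates of the bundle chart. *)
Lemma exists_path (X : TS) : exists c : R -> S2 M,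
  [/\ smooth_path S2_charts c, c 0 = p & velocity S2_charts c = X :> TS].
Proof.
pose q : TS := (chart_map x x, S2_components x p).
pose F (t : R^o) : TS := scalar_line X t + q.
pose c (t : R) := S2_point (chart_tensor x (chart_inv x (F t).1) (F t).2).
have F0 : F (0 : R) = q by rewrite /F /scalar_line scale0r add0r.
have c0 : c 0 = p.
  apply: chart_tensor_center; last exact: (congr1 snd F0).
  apply: (etrans (congr1 (fun y : TS => chart_inv x y.1) F0)).
  exact: chart_mapKd (chart_mem x).
have CF := Ck_affine (fun t => erefl (F t)) (@scalar_line_continuous _ _ X).
have cF : continuous F.
  by move=> t; apply: differentiable_continuous; exact: Ck_diff (CF 0%N).1 _.
pose U : set R^o := setT `&` F @^-1` (fst @^-1` chart_img x).
have oU : open U.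
  apply: open_setI_preimage; [exact: openT| |by move=> t _; exact: cF].
  have -> : fst @^-1` chart_img x = setT `&` (fst : TS -> V) @^-1` chart_img x.
    by rewrite setTI.
  apply: open_setI_preimage; [exact: openT|exact: open_chart_img|].
  by move=> t _; exact: cvg_fst.
have U0 : U 0.
  split=> //.
  exact: (eq_ind_r (chart_img x) (mem_chart_img (chart_mem x)) (congr1 fst F0)).
have FE t : U t -> F t = (Defs.coord S2_charts p \o c) t.
  move=> [_ /chart_imgP[xt tE]]; rewrite [LHS]surjective_pairing; congr pair.
    exact: esym tE.
  apply: esym; apply: (etrans (S2_componentsE x (c t))).
  by rewrite (gram_chart_tensor _ xt) sym_mxK.
exists c; split=> //.
- split.
    rewrite c0; apply: (@filterS _ _ _ U); last exact: open_nbhs_nbhs.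
    by move=> t [_ /= /chart_imgP[]].
  rewrite c0; apply/smooth_nearP; exists U; split=> // k.
  exact: (Ck_eq oU FE (Ck_sub (@subsetT _ _) (CF k).1)).
- rewrite /velocity c0 derive1E.
  apply: (etrans (esym (eq_on_derive (1 : R^o) oU U0 FE))).
  apply: (etrans (congr1 (fun f : R^o -> TS => f 0) ((CF 0%N).2 1))).
  by rewrite /= /scalar_line scale1r.
Qed.

(** The velocity of the transported path involves only the velocity X of the path and
the 2-jet of s, so that the set in the definition of Psi is a singleton. *)
Lemma Psi_formula (js : M -> set (M -> M)) (s : M -> M) (B : V -> V -> V) :
  js x = jet2 x s -> smooth_at mcharts s x -> s x = x ->
  (forall v, 'D_v (rep x s) (chart_map x x) = - v) ->
  (forall v w, 'D_v ('D_w (rep x s)) (chart_map x x) = B v w) ->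
  forall X : TS, Psi js p X =
  (- X.1, X.2 + comp_row (contract_mx B X.1 *m gram x p +
                          gram x p *m (contract_mx B X.1)^T)) :> TS.
Proof.
move=> jsx ss sx Ds DDs X.
have main s' c : js x s' -> smooth_path S2_charts c -> c 0 = p ->
    velocity S2_charts c = X -> velocity S2_charts (push s' \o c) =
  (- X.1, X.2 + comp_row (contract_mx B X.1 *m gram x p +
                          gram x p *m (contract_mx B X.1)^T)) :> TS.
  rewrite jsx => -[ss' s'x iD] cs c0 cX.
  rewrite sx in s'x; rewrite /local_rep s'x sx in iD.
  have Ds' v : 'D_v (rep x s') (chart_map x x) = - v.
    exact: (etrans (iD [:: v] isT) (Ds v)).
  have DDs' v w : 'D_v ('D_w (rep x s')) (chart_map x x) = B v w.
    exact: (etrans (iD [:: v; w] isT) (DDs v w)).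
  have [W sW Wx] := exists_adapted ss' s'x Ds'.
  exact: (push_velocity (g := g) s'x sW Wx Ds' DDs' cs c0 cX).
rewrite /Psi; case: xgetP => [Y -> [s' [c [js' cs c0 cX <-]]]|noY].
  exact: main js' cs c0 cX.
have [c [cs c0 cX]] := exists_path X.
exfalso; apply: (noY (velocity S2_charts (push s \o c))).
by exists s, c; split=> //=; rewrite jsx.
Qed.

End PsiFormula.

(** * Symmetries at a point *)
Section LocalSymmetries.
Context {R : realType} {n : nat} {M : manifold R n}.
Local Notation V := 'rV[R]_n.
Local Notation e i := (delta_mx 0 i : 'rV_n).
Implicit Types (x y z : M) (u v w : V) (s : M -> M).

Lemma smooth_at_chart x (f : V -> V) (U : set V) : open U -> U `<=` chart_img x ->
  (forall k, Ck k U f) -> (forall u, U u -> chart_img x (f u)) ->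
  forall y, chart_dom x y -> U (chart_map x y) ->
  smooth_at mcharts (chart_inv x \o f \o chart_map x) y.
Proof.
move=> oU UI CU fI y xy Uy; set s := _ \o _ \o _.
have sy : s y = chart_inv x (f (chart_map x y)) by [].
have [xsy fsy] := chart_imgP (fI _ Uy); rewrite -sy in xsy fsy.
split=> /=.
  have cs : {for y, continuous s}.
    apply: continuous_comp; first exact: chart_map_continuous.
    apply: continuous_comp; first exact: continuous_Ck CU Uy.
    exact: chart_inv_continuous (fI _ Uy).
  by apply: cs; apply: open_nbhs_nbhs; split; [exact: chart_open|exact: chart_mem].
apply/smooth_nearP.
pose N1 := U `&` f @^-1` overlap x (s y).
have oN1 : open N1.
  apply: open_setI_preimage; [exact: oU|exact: open_overlap|].
  by move=> u; exact: continuous_Ck CU.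
pose N := overlap y x `&` transition y x @^-1` N1.
have oN : open N.
  apply: open_setI_preimage; [exact: open_overlap|exact: oN1|].
  by move=> u yu; apply: continuous_Ck yu => k; exact: Ck_transition.
exists N; split=> //.
  split; first exact: (mem_overlap (chart_mem y) xy).
  rewrite /= (transitionE x (chart_mem y)); split=> //=.
  by rewrite -fsy; apply: mem_overlap => //; exact: chart_mem.
move=> k.
have C1 : Ck k N (transition x (s y) \o (f \o transition y x)).
  apply: (Ck_comp (V := overlap x (s y))) => //.
  - exact: open_overlap.
  - by move=> u [_ []].
  - exact: Ck_transition.
  apply: (Ck_comp (V := U)) => //; first by move=> u [_ []].
  by apply: Ck_sub (Ck_transition y x k) => u [].
refine (Ck_eq oN _ C1) => u [/overlapP[z [yz xz ->]] _] /=.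
by rewrite (transitionE x yz) /local_rep /= (chart_mapKd yz).
Qed.

Lemma mdiff_rep x s v : smooth_at mcharts s x -> s x = x ->
  mdiff mcharts s x v = 'D_v (rep x s) (chart_map x x).
Proof.
move=> [_ /nbhs_singleton/(_ [::]) /=]; rewrite /mdiff /local_rep /= => ds sx.
rewrite sx in ds *; exact: (esym (deriveE v ds)).
Qed.

Lemma exists_symmetry x (B : V -> V -> V) : sym_bilinear B ->
  exists s, symmetry_at x s /\
    forall v w, 'D_v ('D_w (rep x s)) (chart_map x x) = B v w.
Proof.
move=> Bb; have xx := chart_mem x.
have [f [g [U [W [[oU Ux oW Wx] fx [Cf Cg gf fg] [Df DDf] [UI WI]]]]]] :=
  germ_restrict (@open_chart_img _ _ _ x) (@open_chart_img _ _ _ x)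
    (mem_chart_img xx) (mem_chart_img xx) (germ_symmetry (chart_map x x) Bb).
pose s := chart_inv x \o f \o chart_map x.
pose t := chart_inv x \o g \o chart_map x.
have sx : s x = x by rewrite /s /= fx chart_mapKd.
have ssm y : chart_dom x y -> U (chart_map x y) -> smooth_at mcharts s y.
  by apply: smooth_at_chart => // u /gf[/WI].
have tsm y : chart_dom x y -> W (chart_map x y) -> smooth_at mcharts t y.
  by apply: smooth_at_chart => // u /fg[/UI].
have srep u : U u -> f u = rep x s u.
  move=> Uu; have [_ uE] := chart_imgP (UI _ Uu).
  have [Wfu _] := gf _ Uu; have [_ fuE] := chart_imgP (WI _ Wfu).
  by rewrite /rep /s /= uE fuE.
have Drep v u : U u -> 'D_v f u = 'D_v (rep x s) u.
  by move=> Uu; exact: (eq_on_derive v oU Uu srep).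
exists s; split; last first.
  move=> v w; rewrite -DDf; apply: esym.
  by apply: (eq_on_derive v oU Ux) => u Uu; exact: Drep.
split=> //.
  have oP (Z : set V) : open Z -> open (chart_dom x `&` chart_map x @^-1` Z).
    move=> oZ; apply: open_setI_preimage => //; first exact: chart_open.
    by move=> y xy; exact: chart_map_continuous.
  have sE : s @` (chart_dom x `&` chart_map x @^-1` U) =
            chart_dom x `&` chart_map x @^-1` W.
    apply/seteqP; split=> y.
      move=> [z [xz Uz] <-]; have [Wfz _] := gf _ Uz.
      have [xs sE] := chart_imgP (WI _ Wfz).
      by split=> //=; rewrite sE.
    move=> [xy Wy]; have [Ugy fgy] := fg _ Wy.
    have [xt tE] := chart_imgP (UI _ Ugy).
    exists (t y); first by split=> //=; rewrite tE.
    by rewrite /s /= tE fgy chart_mapKd.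
  exists (chart_dom x `&` chart_map x @^-1` U), t; rewrite sE.
  split; [exact: oP|by []|exact: oP| |].
    move=> y; rewrite inE => -[xy Uy]; have [Wfy gfy] := gf _ Uy.
    have [xs sE'] := chart_imgP (WI _ Wfy).
    by rewrite /t /= sE' gfy chart_mapKd.
  by split=> y [xy Uy]; [exact: ssm|exact: tsm].
by move=> X; rewrite (mdiff_rep X (ssm _ xx Ux) sx) -Drep // Df.
Qed.

Lemma symmetry_at_smooth x s : symmetry_at x s ->
  [/\ smooth_at mcharts s x, s x = x &
      forall v, 'D_v (rep x s) (chart_map x x) = - v].
Proof.
move=> [[U [t [_ Ux _ _ [sU _]]]] sx Ds].
have ss := sU _ Ux; split=> // v.
by rewrite -(mdiff_rep v ss sx) Ds.
Qed.

Lemma derive2_sym_bilinear (f : V -> V) (U : set V) u : open U -> U u -> Ck 2 U f ->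
  sym_bilinear (fun v w => 'D_v ('D_w f) u).
Proof.
move=> oU Uu Cf; split=> [v w|c v v' w]; first exact: (derive2_sym v w oU Uu Cf).
by apply: derive_lin; exact: Ck_diff (Ck_derive w Cf) Uu.
Qed.

(** Among the jets of symmetries, only the second derivative varies. *)
Lemma jet2_eq x s s' : smooth_at mcharts s x -> smooth_at mcharts s' x ->
  s x = x -> s' x = x ->
  (forall v, 'D_v (rep x s) (chart_map x x) = - v) ->
  (forall v, 'D_v (rep x s') (chart_map x x) = - v) ->
  (forall v w, 'D_v ('D_w (rep x s)) (chart_map x x) =
               'D_v ('D_w (rep x s')) (chart_map x x)) ->
  jet2 x s = jet2 x s'.
Proof.
move=> ss ss' sx s'x Ds Ds' DDs.
have E (vs : seq V) : (size vs <= 2)%N ->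
   iterD vs (local_rep mcharts s x) (chart_map x x) =
   iterD vs (local_rep mcharts s' x) (chart_map x x).
  have -> : local_rep mcharts s x = rep x s by rewrite /local_rep sx.
  have -> : local_rep mcharts s' x = rep x s' by rewrite /local_rep s'x.
  case: vs => [|v [|w [|z vs]]] hvs.
  - by rewrite /= /rep /= (chart_mapKd (chart_mem x)) sx s'x.
  - exact: (etrans (Ds v) (esym (Ds' v))).
  - exact: DDs.
  - by exfalso.
apply/seteqP; split=> f [fs fx fE]; split.
- exact: fs.
- by rewrite fx sx.
- by move=> vs hvs; apply: (etrans (fE vs hvs)); exact: E.
- exact: fs.
- by rewrite fx s'x.
- by move=> vs hvs; apply: (etrans (fE vs hvs)); apply: esym; exact: E.
Qed.

End LocalSymmetries.

(** * The metric and the eigenvalue condition *)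
Lemma mulmx2_inj (R : realType) m n : injective (fun A : 'M[R]_(m, n) => A *+ 2).
Proof.
move=> A B /matrixP E; apply/matrixP => i j; have := E i j.
rewrite !mulr2n !mxE; lra.
Qed.

Section Metric.
Context {R : realType} {n : nat} {M : manifold R n}.
Local Notation V := 'rV[R]_n.
Local Notation N := #|{: sym_idx n}|.
Local Notation TS := (V * 'rV[R]_N)%type.
Local Notation e i := (delta_mx 0 i : 'rV_n).
Implicit Types (x y z : M) (u v w : V) (s : M -> M).
Variable h : forall x : M, sym2 (TM x).
Hypothesis hh : pseudo_Riemannian_metric h.

Let hS (y : M) : S2 M := S2_point (h y).

Definition metric_mx x u : 'M[R]_n := gram x (hS (chart_inv x u)).

Definition metric_derive x u (a : 'I_n) : 'M[R]_n := 'D_(e a) (metric_mx x) u.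

Lemma metric_mx_sym x u : (metric_mx x u)^T = metric_mx x u.
Proof. exact: gram_sym. Qed.

(** Smoothness of h is given for its components in the chart at x, which are those
of the symmetric matrix. *)
Lemma metric_mx_smooth x : exists U : set V,
  [/\ open U, U (chart_map x x), U `<=` chart_img x & forall k, Ck k U (metric_mx x)].
Proof.
have [hs _] := hh; have [_ /smooth_nearP[U [oU Ux CU]]] := hs x.
exists (U `&` chart_img x).
have oUI : open (U `&` chart_img x) by apply: openI => //; exact: open_chart_img.
split; [exact: oUI|by split=> //; exact: mem_chart_img (chart_mem x)|by move=> u []|].
move=> k; have {}CU := Ck_sub (@subIsetl _ U (chart_img x)) (CU k).
have cs : continuous (snd : TS -> 'rV[R]_N) by move=> q; exact: cvg_snd.
have C1 := Ck_sym_mx oUI (Ck_comp_linear cs oUI CU).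
refine (Ck_eq oUI _ C1) => u Uu.
by rewrite /metric_mx gramE.
Qed.

Lemma metric_mx_unit x u : chart_img x u -> metric_mx x u \in unitmx.
Proof.
move=> /chart_imgP[xz zu]; have [_ nd] := hh.
rewrite -row_free_unit -kermx_eq0; apply/rowV0P => v /sub_kermxP vH.
have F0 : frame x (chart_inv x u) v = 0.
  apply: nd => Y; rewrite -(frameKV Y xz) (sym2_mx (h _) (frame x (chart_inv x u))).
  rewrite (_ : \matrix_(i, j) _ = metric_mx x u); last by apply/matrixP => i j; rewrite !mxE.
  by rewrite vH mul0mx mxE.
set z := chart_inv x u in xz F0.
apply: (etrans (esym (frameK v xz))).
by apply: (etrans (congr1 ('d (transition z x) (chart_map z z)) F0)); exact: linear0.
Qed.

Lemma metric_center x : metric_mx x (chart_map x x) = gram x (hS x).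
Proof. by rewrite /metric_mx chart_mapKd //; exact: chart_mem. Qed.

Lemma metric_derive_sum x u v : differentiable (metric_mx x) u ->
  'D_v (metric_mx x) u = \sum_a v 0 a *: metric_derive x u a.
Proof. by move=> dm; exact: derive_row_sum. Qed.

Lemma metric_derive_sym x u a : differentiable (metric_mx x) u ->
  (metric_derive x u a)^T = metric_derive x u a.
Proof.
move=> dm; apply: (etrans (esym (derive_trmx (e a) dm))).
have E : (fun z : V => (metric_mx x z)^T) = metric_mx x.
  by apply/funext => v; exact: metric_mx_sym.
by rewrite E.
Qed.

Lemma differentiable_metric x : differentiable (metric_mx x) (chart_map x x).
Proof.
by have [U [_ Ux _ CU]] := metric_mx_smooth x; exact: Ck_diff (CU 0%N) Ux.
Qed.

Lemma mdiff_metric x v : mdiff S2_charts hS x v =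
  (v, comp_row ('D_v (metric_mx x) (chart_map x x))) :> TS.
Proof.
have dm := differentiable_metric x.
have [dc Dc] := derive_comp_row v dm.
have [di dI] := is_diff_id (chart_map x x).
have dp := differentiable_pair di dc.
have E : \forall u \near chart_map x x,
    (id u, (comp_row \o metric_mx x) u) = local_rep S2_charts hS x u.
  apply: (@filterS _ _ _ (chart_img x)).
    move=> u /chart_imgP[xu uE]; rewrite /local_rep /= uE; congr pair.
    by rewrite S2_componentsE.
  apply: open_nbhs_nbhs; split; first exact: open_chart_img.
  exact: mem_chart_img (chart_mem x).
have [_ dE] := near_eq_diff E dp.
apply: (etrans (congr1 (fun f : V -> TS => f v) dE)).
apply: (etrans (congr1 (fun f : V -> TS => f v) (diff_pair di dc))).
congr pair; first exact: (congr1 (fun f : V -> V => f v) dI).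
by apply: (etrans (esym (deriveE v dc))).
Qed.

(** Both sets are graphs over the base directions v, so that they are equal as soon as
the fibre parts agree: 2 D_v h = - (B v h + h (B v)^T). *)
Lemma Psi_eigenspaceP x (js : M -> set (M -> M)) s : js x = jet2 x s ->
  smooth_at mcharts s x -> s x = x ->
  (forall v, 'D_v (rep x s) (chart_map x x) = - v) ->
  [set X : tangent S2_charts (hS x) | Psi js (hS x) X = - X] = range (mdiff S2_charts hS x)
  <-> compatible (metric_mx x (chart_map x x)) (metric_derive x (chart_map x x))
        (fun v w => 'D_v ('D_w (rep x s)) (chart_map x x)).
Proof.
move=> jsx ss sx Ds; set B := fun v w => _.
set H := metric_mx x _; set D := metric_derive x _.
have PsiE (X : TS) : Psi js (hS x) X =
   (- X.1, X.2 + comp_row (contract_mx B X.1 *m H + H *m (contract_mx B X.1)^T)) :> TS.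
  by rewrite /H metric_center; exact: Psi_formula jsx ss sx Ds _ X.
have dE v : mdiff S2_charts hS x v = (v, comp_row (\sum_a v 0 a *: D a)) :> TS.
  apply: (etrans (mdiff_metric x v)).
  by rewrite (metric_derive_sum v (differentiable_metric x)).
have Ds' v : (\sum_a v 0 a *: D a)^T = \sum_a v 0 a *: D a.
  rewrite linear_sum /=; apply: eq_bigr => a _; rewrite linearZ /=.
  by rewrite (metric_derive_sym a (differentiable_metric x)).
have Cs v : (contract_mx B v *m H + H *m (contract_mx B v)^T)^T =
    contract_mx B v *m H + H *m (contract_mx B v)^T.
  by rewrite linearD /= !trmx_mul trmxK metric_mx_sym addrC.
have eqP v (r : 'rV[R]_N) :
    r + comp_row (contract_mx B v *m H + H *m (contract_mx B v)^T) = - r <->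
    sym_mx r *+ 2 = - (contract_mx B v *m H + H *m (contract_mx B v)^T).
  split=> [E|E].
    have := congr1 (@sym_mx R n) E.
    rewrite linearD linearN /= comp_rowK // => /(canRL (addrK _)) E'.
    by rewrite mulr2n {1}E' addrAC addNr add0r.
  rewrite -[X in comp_row X]opprK -E linearN linearMn /= sym_mxK mulr2n opprD.
  by rewrite addrA subrr add0r.
split=> [E v|Bc].
  have : range (mdiff S2_charts hS x) (mdiff S2_charts hS x v) by exists v.
  rewrite -E /= dE PsiE /= => -[] /eqP.
  by rewrite comp_rowK.
apply/seteqP; split=> [[v r] /=|_ [v _ <-] /=].
  rewrite PsiE /= => -[] /eqP rE; exists v => //; rewrite dE; congr pair.
  have vc := Bc v; rewrite -rE in vc.
  have -> := mulmx2_inj vc.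
  exact: sym_mxK.
rewrite dE PsiE /=; congr pair; apply/eqP.
by rewrite comp_rowK.
Qed.

End Metric.

(** * Change of charts *)
Section ChartChange.
Context {R : realType} {n : nat} {M : manifold R n}.
Local Notation V := 'rV[R]_n.
Local Notation e i := (delta_mx 0 i : 'rV_n).
Implicit Types (x y z : M) (u v w : V) (s : M -> M).

Lemma jacobian_transition_unit x0 x z : chart_dom x0 z -> chart_dom x z ->
  jacobian (transition x0 x) (chart_map x0 z) \in unitmx.
Proof.
move=> x0z xz.
have d1 := differentiable_transition x0z xz.
have d2 := differentiable_transition xz x0z.
apply: (mulmx1_unit (B := jacobian (transition x x0) (chart_map x z)) _).1.
apply/row_matrixP => i; rewrite !rowE mulmxA mulmx1.
have E1 := etrans (esym (jacobianP (e i) d1)) (deriveE (e i) d1).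
apply: (etrans (esym (jacobianP _ d2))); apply: (etrans (deriveE _ d2)).
apply: (etrans (congr1 ('d (transition x x0) (chart_map x z)) E1)).
apply: (etrans (esym (diff_transition_comp _ x0z xz x0z))).
exact: diff_transition_id.
Qed.

(** The inhomogeneous term - 2 DJ in the transformation of C is that of - 2 times the
Christoffel symbols; it absorbs the derivatives of the Jacobian in the
derivative of J H J^T. *)
Lemma conjugate_compatible (J DJ C C0 H H' : 'M[R]_n) :
  C0 *m J = J *m C - DJ *+ 2 -> H' *+ 2 = - (C *m H + H *m C^T) ->
  (DJ *m H *m J^T + J *m H' *m J^T + J *m H *m DJ^T) *+ 2 =
  - (C0 *m (J *m H *m J^T) + (J *m H *m J^T) *m C0^T).
Proof.
move=> E E'.
have E1 : C0 *m (J *m H *m J^T) = J *m C *m H *m J^T - (DJ *m H *m J^T) *+ 2.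
  by rewrite !mulmxA E !mulmxBl !mulr2n !mulmxDl.
have E2 : (J *m H *m J^T) *m C0^T = J *m H *m C^T *m J^T - (J *m H *m DJ^T) *+ 2.
  rewrite -mulmxA -trmx_mul E linearB /= trmx_mul mulmxBr !mulmxA.
  by rewrite mulr2n linearD /= mulmxDr -mulr2n.
have E3 : (J *m H' *m J^T) *+ 2 = - (J *m C *m H *m J^T + J *m H *m C^T *m J^T).
  rewrite mulr2n in E'; rewrite mulr2n -[LHS]mulmxDl -[in LHS]mulmxDr E'.
  rewrite mulmxN mulNmx mulmxDr mulmxDl.
  by rewrite !mulmxA.
have G (T : zmodType) (p q c d : T) : p - (c + d) + q = - (c - p + (d - q)).
  by rewrite !opprD !opprK !addrA [p - c]addrC.
rewrite !mulrnDl E3 E1 E2; exact: G.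
Qed.

Variable h : forall x : M, sym2 (TM x).
Hypothesis hh : pseudo_Riemannian_metric h.

Lemma metric_mx_transition x0 x u : overlap x0 x u ->
  let J := jacobian (transition x0 x) u in
  metric_mx h x0 u = J *m metric_mx h x (transition x0 x u) *m J^T.
Proof.
move=> /overlapP[z [x0z xz ->]]; rewrite (transitionE x x0z) /metric_mx.
rewrite (chart_mapKd x0z) (chart_mapKd xz); set J := jacobian _ _.
have d := differentiable_transition x0z xz.
have FE i : frame x0 z (e i) = frame x z (e i *m J).
  apply: (etrans (frame_comp (e i) x0z xz)); congr (frame x z _).
  by apply: (etrans (esym (deriveE (e i) d))); exact: jacobianP.
apply/matrixP => i j.
have L : gram x0 (S2_point (h z)) i j = h z (frame x0 z (e i)) (frame x0 z (e j)).
  by rewrite [LHS]mxE.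
apply: (etrans L).
apply: (etrans (congr2 (fun X Y => h z X Y) (FE i) (FE j))).
apply: (etrans (sym2_mx (h z) (frame x z) _ _)).
by rewrite -[RHS]form_delta trmx_mul !mulmxA.
Qed.

Section AtPoint.
Variables (x0 x : M) (s : M -> M).
Hypothesis x0x : chart_dom x0 x.
Hypothesis ss : smooth_at mcharts s x.
Hypothesis sx : s x = x.
Hypothesis Ds : forall v, 'D_v (rep x s) (chart_map x x) = - v.
Let B v w := 'D_v ('D_w (rep x s)) (chart_map x x).
Hypothesis Bc : compatible (metric_mx h x (chart_map x x))
  (metric_derive h x (chart_map x x)) B.

Let a := chart_map x0 x.
Let phi := transition x0 x.
Let theta := rep x0 s.
Let J := jacobian phi a.

(** On a small neighbourhood the representatives of s in the two charts are conjugate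
by the transition map. *)
Lemma exists_change_domain : exists U : set V,
  [/\ open U /\ U a, U `<=` overlap x0 x, forall k, Ck k U theta,
      (forall u, U u -> overlap x0 x (theta u)) &
      exists2 W, adapted x s W &
      (forall u, U u -> W (phi u) /\ phi (theta u) = rep x s (phi u))].
Proof.
have xx := chart_mem x.
have [W sW Wx] := exists_adapted ss sx Ds.
have oW := adapted_open sW.
have rx : rep x s (chart_map x x) = chart_map x x.
  by rewrite /rep /= (chart_mapKd xx) sx.
pose W1 := W `&` rep x s @^-1` overlap x x0.
have oW1 : open W1.
  apply: open_setI_preimage; [exact: oW|exact: open_overlap|].
  by move=> u; exact: continuous_Ck (adapted_Ck sW).
pose U := overlap x0 x `&` phi @^-1` W1.
have oU : open U.
  apply: open_setI_preimage; [exact: open_overlap|exact: oW1|].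
  by move=> u ou; apply: continuous_Ck ou => k; exact: Ck_transition.
have phia : phi a = chart_map x x by exact: transitionE.
have key u : U u -> exists z, [/\ chart_dom x0 z, chart_dom x z, chart_dom x (s z),
    chart_dom x0 (s z) & u = chart_map x0 z].
  move=> [/overlapP[z [x0z xz ->]]]; rewrite /= /phi (transitionE x x0z) => -[Wz].
  have xsz := adapted_dom sW Wz; rewrite (chart_mapKd xz) in xsz.
  by move=> [_]; rewrite /= /rep /= (chart_mapKd xz) (chart_mapKd xsz); exists z.
have thetaE u : U u -> (transition x x0 \o (rep x s \o phi)) u = theta u.
  move=> /key[z [x0z xz xsz x0sz ->]]; rewrite /= /phi (transitionE x x0z).
  by rewrite /rep /= (chart_mapKd xz) (transitionE x0 xsz) /theta /rep /= (chart_mapKd x0z).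
exists U; split.
- split; first exact: oU.
  split; first exact: mem_overlap.
  rewrite /= phia; split=> //=; rewrite rx; exact: mem_overlap.
- by move=> u [].
- move=> k; refine (Ck_eq oU thetaE _).
  apply: (Ck_comp (V := overlap x x0)) => //.
  + exact: open_overlap.
  + by move=> u [_ []].
  + exact: Ck_transition.
  apply: (Ck_comp (V := W)) => //.
  + by move=> u [_ []].
  + exact: adapted_Ck sW k.
  + by apply: Ck_sub (Ck_transition x0 x k) => u [].
- move=> u /key[z [x0z xz xsz x0sz ->]].
  by rewrite /theta /rep /= (chart_mapKd x0z); exact: mem_overlap.
- exists W => // u Uu; split; first by case: Uu => _ [].
  have [z [x0z xz xsz x0sz ->]] := key _ Uu.
  rewrite /theta /phi /rep /= (transitionE x x0z) (chart_mapKd x0z) (chart_mapKd xz).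
  exact: transitionE.
Qed.

(** The derivatives of order 1 and 2 of the identity phi o theta = rep x s o phi. In
the second one D^2 phi occurs on both sides, with opposite signs because
the differential - id is applied twice on the left and once on the right. *)
Lemma change_derivatives :
  [/\ theta a = a, forall v, 'D_v theta a = - v,
      sym_bilinear (fun v w => 'D_v ('D_w theta) a) &
      forall v w, 'D_v ('D_w theta) a *m J =
        B (v *m J) (w *m J) - 'D_v ('D_w phi) a *+ 2].
Proof.
have [U [[oU Ua] UO Ct tO [W sW UW]]] := exists_change_domain.
have oW := adapted_open sW.
have oO : open (overlap x0 x) by exact: open_overlap.
have Oa := UO _ Ua.
have phia : phi a = chart_map x x by exact: transitionE.
have Wx : W (chart_map x x) by have := (UW _ Ua).1; rewrite phia.
have ta : theta a = a by rewrite /theta /rep /a /= (chart_mapKd x0x) sx.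
have Ju : J \in unitmx by exact: jacobian_transition_unit (chart_mem x).
have Cphi k : Ck k (overlap x0 x) phi by exact: Ck_transition.
have CphiU k : Ck k U phi by exact: Ck_sub UO (Cphi k).
have dphi := Ck_diff (Cphi 0%N) Oa.
have dtheta := Ck_diff (Ct 0%N) Ua.
have drep : differentiable (rep x s) (phi a).
  by rewrite phia; exact: Ck_diff (adapted_Ck sW 0) Wx.
have phi'E v : 'D_v phi a = v *m J by exact: jacobianP.
have dphit : differentiable phi (theta a) by rewrite ta.
have eqU u : U u -> (phi \o theta) u = (rep x s \o phi) u by move=> /UW[].
have D1 v : 'D_v theta a = - v.
  have E := eq_on_derive v oU Ua eqU.
  have E1 := derive_comp v dtheta dphit.
  have E2 := derive_comp v dphi drep.
  rewrite ta phi'E in E1; rewrite phia Ds phi'E -mulNmx in E2.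
  by apply: (can_inj (mulmxK Ju)); rewrite -E1 -E2.
have Bt := derive2_sym_bilinear oU Ua (Ct 2%N).
have Bphi := derive2_sym_bilinear oO Oa (Cphi 2%N).
split=> // v w.
have E : 'D_v ('D_w (phi \o theta)) a = 'D_v ('D_w (rep x s \o phi)) a.
  by apply: (eq_on_derive v oU Ua) => u Uu; exact: (eq_on_derive w oU Uu eqU).
have E1 := derive2_comp v w oO oU tO (Cphi 2%N) (Ct 2%N) Ua.
have E2 := derive2_comp v w oW oU (fun u Uu => (UW u Uu).1) (adapted_Ck sW 2) (CphiU 2%N) Ua.
have N1 : 'D_(- v) ('D_(- w) phi) a = 'D_v ('D_w phi) a := bilinear_opp v w Bphi.
rewrite !D1 ta N1 phi'E in E1.
rewrite phia Ds !phi'E in E2.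
have : 'D_v ('D_w phi) a + 'D_v ('D_w theta) a *m J =
       B (v *m J) (w *m J) - 'D_v ('D_w phi) a.
  by apply: (etrans (esym E1)); apply: (etrans E E2).
move=> /(canRL (addKr _)) ->; rewrite mulr2n opprD addrC addrA; exact: addrAC.
Qed.

(** Differentiating metric = J H J^T, where H is the metric in the chart at x, brings in
the second derivatives of phi, which compensate those in change_derivatives. *)
Lemma change_compatible :
  compatible (metric_mx h x0 a) (metric_derive h x0 a)
    (fun v w => 'D_v ('D_w theta) a) /\ differentiable (metric_mx h x0) a.
Proof.
have [_ _ B0s B0J] := change_derivatives.
have oO : open (overlap x0 x) by exact: open_overlap.
have Oa : overlap x0 x a by exact: mem_overlap (chart_mem x).
have phia : phi a = chart_map x x by exact: transitionE.
have Cphi k : Ck k (overlap x0 x) phi by exact: Ck_transition.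
have dphi := Ck_diff (Cphi 0%N) Oa.
have dJ := Ck_diff (Ck_jacobian oO (Cphi 1%N)) Oa.
have [W sW Wx] := exists_adapted ss sx Ds.
have Bs : sym_bilinear B.
  exact: derive2_sym_bilinear (adapted_open sW) Wx (adapted_Ck sW 2).
set H := metric_mx h x (chart_map x x).
have dm : differentiable (metric_mx h x) (phi a).
  by rewrite phia; exact: differentiable_metric.
pose G : V -> 'M[R]_n := metric_mx h x \o phi.
have dG : differentiable G a by exact: differentiable_comp.
have Ga : G a = H by rewrite /G /= phia.
have dJG := differentiable_mulmx dJ dG.
have dJT := differentiable_trmx dJ.
pose P u := jacobian phi u *m G u *m (jacobian phi u)^T.
have dP : differentiable P a by exact: differentiable_mulmx dJG dJT.
have PE u : overlap x0 x u -> P u = metric_mx h x0 u.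
  by move=> /metric_mx_transition ->.
have dm0 : differentiable (metric_mx h x0) a.
  exact: near_eq_differentiable (eq_on_near oO PE Oa) dP.
split; last exact: dm0.
move=> v.
pose DJ : 'M[R]_n := \matrix_i 'D_v ('D_(e i) phi) a.
pose H' := 'D_(v *m J) (metric_mx h x) (chart_map x x).
have DJE : 'D_v (jacobian phi) a = DJ by exact: derive_jacobian v oO Oa (Cphi 2%N).
have phi'E : 'D_v phi a = v *m J by exact: jacobianP.
have DGE : 'D_v G a = H'.
  by apply: (etrans (derive_comp v dphi dm)); rewrite phi'E phia.
have DP : 'D_v (metric_mx h x0) a = DJ *m H *m J^T + J *m H' *m J^T + J *m H *m DJ^T.
  apply: (etrans (esym (eq_on_derive v oO Oa PE))).
  apply: (etrans (derive_mulmx v dJG dJT)).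
  have -> := derive_mulmx v dJ dG; have -> := derive_trmx v dJ.
  by rewrite DJE DGE Ga mulmxDl.
have C0J : contract_mx (fun v w => 'D_v ('D_w theta) a) v *m J =
    J *m contract_mx B (v *m J) - DJ *+ 2.
  apply/row_matrixP => i; rewrite !rowE mulmxA mulmxBr mulmxA.
  have -> : e i *m contract_mx (fun v w => 'D_v ('D_w theta) a) v = 'D_v ('D_(e i) theta) a.
    by rewrite -rowE rowK.
  rewrite B0J (contract_mxE _ _ Bs); congr (_ - _).
  by rewrite mulr2n mulmxDr -rowE rowK -mulr2n.
have HC : H' *+ 2 = - (contract_mx B (v *m J) *m H + H *m (contract_mx B (v *m J))^T).
  rewrite /H' (metric_derive_sum (v *m J) (differentiable_metric hh x)); exact: Bc.
have H0E : metric_mx h x0 a = J *m H *m J^T.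
  exact: (etrans (esym (PE a Oa)) (congr1 (fun A : 'M[R]_n => J *m A *m J^T) Ga)).
rewrite -(metric_derive_sum v dm0) DP H0E.
exact: (conjugate_compatible C0J HC).
Qed.

End AtPoint.

(** Hence the second derivative of s in the chart at x0 is given by the Koszul formula
in that chart, whichever chart was used to build s. *)
Lemma change_second_derivative x0 x s : chart_dom x0 x ->
  smooth_at mcharts s x -> s x = x ->
  (forall v, 'D_v (rep x s) (chart_map x x) = - v) ->
  compatible (metric_mx h x (chart_map x x)) (metric_derive h x (chart_map x x))
    (fun v w => 'D_v ('D_w (rep x s)) (chart_map x x)) ->
  let a := chart_map x0 x in
  (forall v, 'D_v (rep x0 s) a = - v) /\
  (forall v w, 'D_v ('D_w (rep x0 s)) a =
     koszul (metric_mx h x0 a) (metric_derive h x0 a) v w).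
Proof.
move=> x0x ss sx Ds Bc a.
have [_ D1 Bs _] := change_derivatives x0x ss sx Ds.
have [Cc dm] := change_compatible x0x ss sx Ds Bc.
split=> // v w.
apply: (koszul_unique _ _ Bs _ Cc).
- by apply: metric_mx_unit => //; exact: mem_chart_img.
- exact: metric_mx_sym.
- by move=> b; exact: metric_derive_sym.
Qed.

End ChartChange.

(** * Existence and uniqueness *)
Section Main.
Context {R : realType} {n : nat} {M : manifold R n}.
Local Notation V := 'rV[R]_n.
Local Notation e i := (delta_mx 0 i : 'rV_n).
Implicit Types (x y z : M) (u v w : V) (s : M -> M).

Lemma Ck_koszul (U : set V) (H : V -> 'M[R]_n) v w k : open U ->
  (forall k, Ck k U H) -> (forall u, U u -> H u \in unitmx) ->
  Ck k U (fun u => koszul (H u) (fun a => 'D_(e a) H u) v w).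
Proof.
move=> oU CH Hu; rewrite /koszul.
apply: Ck_sum => // a _; apply: Ck_sum => // i _.
have CD b l m : Ck k U (fun u => ('D_(e b) H u) l m).
  exact: ((Ck_mxP k ('D_(e b) H) oU).1 (Ck_derive (e b) (CH k.+1)) l m).
have Crow : Ck k U (fun u => koszul_row (fun a => 'D_(e a) H u) a i).
  apply/(Ck_mxP _ _ oU) => l m.
  have C1 := CkN oU (CkD oU (CkD oU (CD a i m) (CD i a m)) (CkN oU (CD m a i))).
  refine (Ck_eq oU _ C1) => u Uu; by rewrite mxE.
have C2 := Ck_mulmx oU (Ck_cst k U (v 0 a * w 0 i)%:M)
  (Ck_mulmx oU Crow (Ck_invmx oU Hu (CH k))).
refine (Ck_eq oU _ C2) => u Uu; exact: mul_scalar_mx.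
Qed.

Variable h : forall x : M, sym2 (TM x).
Hypothesis hh : pseudo_Riemannian_metric h.

(** Minus twice the Christoffel symbols: the second derivative of the geodesic symmetry
exp_x (X) |-> exp_x (- X). *)
Definition geodesic_second_derivative x : V -> V -> V :=
  koszul (metric_mx h x (chart_map x x)) (metric_derive h x (chart_map x x)).

Lemma metric_derive_sym_center x a :
  (metric_derive h x (chart_map x x) a)^T = metric_derive h x (chart_map x x) a.
Proof. exact/metric_derive_sym/differentiable_metric. Qed.

Lemma metric_unit_center x : metric_mx h x (chart_map x x) \in unitmx.
Proof. exact/metric_mx_unit/mem_chart_img/chart_mem. Qed.

Lemma compatible_geodesic x s :
  (forall v w, 'D_v ('D_w (rep x s)) (chart_map x x) = geodesic_second_derivative x v w) ->
  compatible (metric_mx h x (chart_map x x)) (metric_derive h x (chart_map x x))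
    (fun v w => 'D_v ('D_w (rep x s)) (chart_map x x)).
Proof.
move=> DDs.
have -> : (fun v w => 'D_v ('D_w (rep x s)) (chart_map x x)) = geodesic_second_derivative x.
  by apply/funext => v; apply/funext => w.
apply: koszul_compatible; [exact: metric_unit_center|exact: metric_mx_sym|].
exact: metric_derive_sym_center.
Qed.

Lemma smooth_geodesic_field (s : M -> M -> M) :
  (forall x, symmetry_at x (s x) /\
    forall v w, 'D_v ('D_w (rep x (s x))) (chart_map x x) = geodesic_second_derivative x v w) ->
  smooth_jet2_field s.
Proof.
move=> sP x0 /=; have [[_ sx0 _] _] := sP x0; rewrite sx0.
have xx0 := chart_mem x0.
have sE x : s x x = x by have [[]] := sP x.
have [U [oU Ux UI CU]] := metric_mx_smooth hh x0.
split.
  apply: (@filterS _ _ _ (chart_dom x0)); first by move=> x; rewrite sE.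
  by apply: open_nbhs_nbhs; split; [exact: chart_open|].
have key u : U u -> let r := chart_map x0 \o s (chart_inv x0 u) \o chart_inv x0 in
    [/\ r u = u, forall v, 'D_v r u = - v & forall v w, 'D_v ('D_w r) u =
     koszul (metric_mx h x0 u) (fun a => 'D_(e a) (metric_mx h x0) u) v w].
  move=> Uu r; have [x0x uE] := chart_imgP (UI _ Uu).
  set x := chart_inv x0 u in x0x uE r *.
  have [sx DDs] := sP x; have [ss sxx Ds] := symmetry_at_smooth sx.
  have [D1 D2] := change_second_derivative hh x0x ss sxx Ds (compatible_geodesic DDs).
  rewrite uE in D1 D2; split; [|exact: D1|exact: D2].
  by rewrite /r /= -/x sE.
move=> vs hvs; apply/smooth_nearP; exists U; split=> // k.
case: vs hvs => [|v [|w [|z vs]]] hvs.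
- have C := Ck_sub (@subsetT _ U) (Ck_id k setT).
  by refine (Ck_eq oU _ C) => u /key[].
- by refine (Ck_eq oU _ (Ck_cst k U (- v))) => u /key[_ D1 _]; rewrite /= D1.
- have C := Ck_koszul v w k oU CU (fun u Uu => metric_mx_unit hh (UI u Uu)).
  by refine (Ck_eq oU _ C) => u /key[_ _ D2]; rewrite /= D2.
- by exfalso.
Qed.

End Main.

Theorem proposition10p2 (R : realType) (n : nat) (M : manifold R n)
    (h : forall x : M, sym2 (TM x)) (hh : pseudo_Riemannian_metric h) :
  exists! js : M -> set (M -> M),
    holonomic_symmetry_jet js /\
    forall x : M,
      [set X : tangent S2_charts (S2_point (h x)) | Psi js (S2_point (h x)) X = - X] =
      range (mdiff S2_charts (fun y => S2_point (h y)) x).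
Proof.
have exs x : exists s, symmetry_at x s /\
    forall v w, 'D_v ('D_w (rep x s)) (chart_map x x) = geodesic_second_derivative h x v w.
  apply: exists_symmetry; apply: koszul_sym => a; exact: metric_derive_sym_center.
have [s sP] := choice exs.
have sS x := symmetry_at_smooth (sP x).1.
exists (fun x => jet2 x (s x)); split.
  split; first by exists s; split=> //; [move=> x; exact: (sP x).1|exact: smooth_geodesic_field sP].
  move=> x; have [ss sx Ds] := sS x.
  apply: (Psi_eigenspaceP hh (js := fun x => jet2 x (s x)) erefl ss sx Ds).2.
  exact: compatible_geodesic (sP x).2.
move=> js [[s' [s'P jsE s'smooth]] eig]; apply/funext => x; rewrite jsE.
have [ss sx Ds] := sS x; have [ss' sx' Ds'] := symmetry_at_smooth (s'P x).
have Bc := (Psi_eigenspaceP hh (jsE x) ss' sx' Ds').1 (eig x).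
have [W sW Wx] := exists_adapted ss' sx' Ds'.
have Bs := derive2_sym_bilinear (adapted_open sW) Wx (adapted_Ck sW 2).
apply: (jet2_eq ss ss' sx sx' Ds Ds') => v w.
apply: (etrans ((sP x).2 v w)); apply: esym.
apply: (koszul_unique _ _ Bs _ Bc); [exact: metric_unit_center|exact: metric_mx_sym|].
exact: metric_derive_sym_center.
Qed.
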